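(* Let $(\mu_t:t\ge0)$ be a generalized CDR model, with associated operators $(A_t:t\ge0)$ and inhomogeneous transition semigroup $(P_{r,t}:t\ge r\ge0)$. An $\mathbb{R}_+$-valued càdlàg $(\mathscr{F}_t)$-adapted process $(X_t:t\ge0)$ is a Markov process (relative to $(\mathscr{F}_t)$) with inhomogeneous transition semigroup $(P_{r,t}:t\ge r\ge0)$ if and only if it solves the $(A_t)$-martingale problem, i.e. if and only if for every $f\in\mathrm{b}\mathscr{C}^1(\mathbb{R}_+)$ the process $$M_t(f)=f(X_t)-f(X_0)-\int_0^tA_sf(X_s)\,\mathrm{d}s,\quad t\ge0,$$ is an $(\mathscr{F}_t)$-martingale.
   Context: $\mathbb{R}_+=[0,\infty)$. $a\ge0$ is a fixed constant and $q=\{q_1,q_2,\dots\}$ is a fixed probability distribution on $\{1,2,\dots\}$. For a Borel probability measure $\mu$ on $\mathbb{R}_+$, $\mu^q=\sum_{i=1}^\infty q_i\mu^{*i}$ with $\mu^{*i}$ the $i$-fold convolution. $\langle\gamma,f\rangle=\int f\,\mathrm{d}\gamma$ and $T_cf(x)=f((x-c)_+)$ for $c,x\ge0$. $\mathrm{b}\mathscr{B}(\mathbb{R}_+)$ is the set of bounded Borel functions on $\mathbb{R}_+$; $\mathrm{b}\mathscr{C}^1(\mathbb{R}_+)$ is the set of bounded continuous functions on $\mathbb{R}_+$ with bounded continuous first derivative; $\mathrm{b}\mathscr{C}^1_*(\mathbb{R}_+)$ is the subset of those with $f'(0)=0$. The underlying complete probability space carries a filtration $(\mathscr{F}_t:t\ge0)$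 satisfying the usual hypotheses. A generalized CDR model is a family of Borel probability measures $(\mu_t:t\ge0)$ on $\mathbb{R}_+$ with $\partial_t\langle\mu_t,f\rangle=a\langle\mu_t*\mu_t^q-\mu_t,f\rangle-\langle\mu_t,f'1_{(0,\infty)}\rangle$, $t\ge0$, for every $f\in\mathrm{b}\mathscr{C}^1_*(\mathbb{R}_+)$. For $f\in\mathrm{b}\mathscr{C}^1(\mathbb{R}_+)$, $$A_tf(x)=a\int_{\mathbb{R}_+}[f(x+z)-f(x)]\,\mu_t^q(\mathrm{d}z)-f'(x)1_{\{x>0\}},\quad x\ge0.$$ For each $r\ge0$ and $x\ge0$, $(P_{r,t}(x,\cdot):t\ge r)$ is the unique family of Borel probability measures on $\mathbb{R}_+$ with $P_{r,r}(x,\cdot)=\delta_x$ such that $\nu_t=P_{r,t}(x,\cdot)$ satisfies, for every $f\in\mathrm{b}\mathscr{B}(\mathbb{R}_+)$, $$\langle\nu_t,f\rangle=\mathrm{e}^{a(r-t)}\langle\nu_r,T_{t-r}f\rangle+a\int_r^t\mathrm{e}^{a(s-t)}\langle\nu_s*\mu_s^q,T_{t-s}f\rangle\,\mathrm{d}s,\quad t\ge r.$$ The kernels $(P_{r,t}:t\ge r\ge0)$ form an inhomogeneous Markov transition semigroup on $\mathbb{R}_+$. *)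

(* Defs.v *)
From HB Require Import structures.
From mathcomp Require Import all_boot all_order all_algebra.
From mathcomp Require Import all_classical all_reals all_analysis measurable_realfun.

Set Implicit Arguments.
Unset Strict Implicit.
Unset Printing Implicit Defensive.
Import Order.TTheory GRing.Theory Num.Theory.
Import numFieldNormedType.Exports.
Local Open Scope classical_set_scope.
Local Open Scope ring_scope.

(* Functions and measures on [0, +oo[ are represented by functions and measures
   on R: a function is only ever looked at on the half-line, and a probability
   measure on the half-line is a probability on R giving it mass 1. *)
Section halfline.
Context {R : realType}.
Implicit Types (f : R -> R) (m : {measure set R -> \bar R}).

Definition Rp : set R := `[0, +oo[.

Definition on_Rp m : Prop := m Rp = 1%E.

Definition pairing m f : R := \int[m]_(x in Rp) f x.

(* Difference quotients use points of the half-line only, so that the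
   derivative at 0 is the right derivative. *)
Definition diff_quot f (x y : R) : R := (f y - f x) / (y - x).

Definition has_deriv f (x l : R) : Prop :=
  diff_quot f x y @[y --> within Rp x^'] --> l.

Definition deriv_Rp f (x : R) : R := lim (diff_quot f x y @[y --> within Rp x^']).

Definition bounded_borel f : Prop :=
  measurable_fun Rp f /\ [bounded f x | x in Rp].

Definition bounded_C1 f : Prop :=
  [/\ {within Rp, continuous f} /\ [bounded f x | x in Rp],
      forall x, Rp x -> has_deriv f x (deriv_Rp f x),
      {within Rp, continuous (deriv_Rp f)} &
      [bounded deriv_Rp f x | x in Rp]].

Definition bounded_C1_star f : Prop := bounded_C1 f /\ deriv_Rp f 0 = 0.

Definition drift (c : R) f : R -> R := fun x => f (Num.max (x - c) 0).

End halfline.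

Section convolution.
Context {R : realType}.

Definition addp (p : R * R) : R := p.1 + p.2.

Lemma measurable_addp : measurable_fun [set: R * R] addp.
Proof. exact: measurable_funD. Qed.

HB.instance Definition _ := isMeasurableFun.Build _ _ _ _ addp measurable_addp.

Section convol.
Variables (m1 : {measure set R -> \bar R}) (m2 : probability R R).

Definition convol : set R -> \bar R := pushforward (m1 \x m2)%E addp.

Let convol0 : convol set0 = 0%E. Proof. exact: measure0. Qed.

Let convol_ge0 A : (0 <= convol A)%E. Proof. exact: measure_ge0. Qed.

Let convol_sigma_additive : semi_sigma_additive convol.
Proof. exact: measure_semi_sigma_additive. Qed.

HB.instance Definition _ :=
  isMeasure.Build _ _ _ convol convol0 convol_ge0 convol_sigma_additive.

End convol.

Let convol_setT (m1 m2 : probability R R) : convol m1 m2 [set: R] = 1%E.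
Proof. by rewrite /convol /pushforward preimage_setT probability_setT. Qed.

HB.instance Definition _ (m1 m2 : probability R R) :=
  Measure_isProbability.Build _ _ _ (convol m1 m2) (convol_setT m1 m2).

Fixpoint convol_pow (m : probability R R) (i : nat) : probability R R :=
  if i is j.+1 then convol m (convol_pow m j) else \d_(0 : R).

End convolution.

(* Probability distributions on {1, 2, ...}; the value at 0 is irrelevant. *)
Record posdist (R : realType) := PosDist {
  posdist_fun :> nat -> {nonneg R} ;
  posdist_sum : (\sum_(1 <= i <oo) ((posdist_fun i)%:num)%:E = 1)%E }.

Section mixture.
Context {R : realType}.
Variables (q : posdist R) (m : probability R R).

Definition convol_mix : set R -> \bar R :=
  mseries (fun i => mscale (q i) (convol_pow m i)) 1.

HB.instance Definition _ := Measure.on convol_mix.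

Let convol_mix_setT : convol_mix [set: R] = 1%E.
Proof.
rewrite /convol_mix /mseries -[RHS](posdist_sum q).
apply: eq_eseriesr => i _.
by rewrite -[RHS]mule1 -(probability_setT (convol_pow m i)).
Qed.

HB.instance Definition _ :=
  Measure_isProbability.Build _ _ _ convol_mix convol_mix_setT.

End mixture.

Section CDR.
Context {R : realType}.
Variables (a : R) (q : posdist R) (mu : R -> probability R R).

(* At t = 0 the time derivative is a right derivative. *)
Definition generalized_CDR : Prop :=
  (forall t, 0 <= t -> on_Rp (mu t)) /\
  (forall f, bounded_C1_star f -> forall t, 0 <= t ->
    has_deriv (fun s => pairing (mu s) f) t
      (a * (pairing (convol (mu t) (convol_mix q (mu t))) f - pairing (mu t) f)
       - pairing (mu t) (fun x => deriv_Rp f x * \1_(`]0, +oo[) x))).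

Definition CDR_generator (t : R) (f : R -> R) (x : R) : R :=
  a * \int[convol_mix q (mu t)]_(z in Rp) (f (x + z) - f x)
  - deriv_Rp f x * \1_(`]0, +oo[) x.

(* The integrability clause says that the time integral in the equation is
   well defined; the integrand being bounded, this amounts to measurability. *)
Definition evolution_eq (r : R) (nu : R -> {measure set R -> \bar R}) : Prop :=
  forall f, bounded_borel f -> forall t, r <= t ->
  let g s := expR (a * (s - t)) *
    pairing (convol (nu s) (convol_mix q (mu s))) (drift (t - s) f) in
  (@lebesgue_measure R).-integrable `[r, t] (EFin \o g) /\
  pairing (nu t) f = expR (a * (r - t)) * pairing (nu r) (drift (t - r) f)
                     + a * \int[@lebesgue_measure R]_(s in `[r, t]) g s.

(* The conditions determine P r t x for 0 <= r <= t and 0 <= x; the other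
   values are irrelevant. *)
Definition CDR_semigroup (P : R -> R -> R.-pker R ~> R) : Prop :=
  forall r x, 0 <= r -> 0 <= x ->
  [/\ forall t, r <= t -> on_Rp (P r t x),
      forall B, measurable B -> P r r x B = \d_x B &
      evolution_eq r (fun t => P r t x)].

End CDR.

Section processes.
Context {R : realType} {d : measure_display} {Omega : measurableType d}.
Variable Pr : probability Omega R.
Implicit Types (F : R -> set (set Omega)) (X M : R -> Omega -> R).

Definition filtration F : Prop :=
  [/\ forall t, 0 <= t -> sigma_algebra setT (F t),
      forall t, 0 <= t -> F t `<=` measurable &
      forall s t, 0 <= s -> s <= t -> F s `<=` F t].

Definition usual_hypotheses F : Prop :=
  Pr.-negligible `<=` F 0 /\
  forall t, 0 <= t -> \bigcap_(s in `]t, +oo[) F s = F t.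

Definition measurable_wrt (G : set (set Omega)) (Y : Omega -> R) : Prop :=
  forall B, measurable B -> G (Y @^-1` B).

Definition adapted F X : Prop := forall t, 0 <= t -> measurable_wrt (F t) (X t).

Definition cadlag X : Prop := forall w,
  (forall t, 0 <= t -> X s w @[s --> t^'+] --> X t w) /\
  (forall t, 0 < t -> cvg (X s w @[s --> t^'-])).

(* Y is a version of the conditional expectation of Z given G. *)
Definition is_cond_exp (G : set (set Omega)) (Z Y : Omega -> R) : Prop :=
  [/\ Pr.-integrable setT (EFin \o Z), Pr.-integrable setT (EFin \o Y),
      measurable_wrt G Y &
      forall B, G B ->
        (\int[Pr]_(w in B) (Y w)%:E = \int[Pr]_(w in B) (Z w)%:E)%E].

Definition martingale F M : Prop :=
  [/\ adapted F M,
      forall t, 0 <= t -> Pr.-integrable setT (EFin \o M t) &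
      forall r t, 0 <= r -> r <= t -> is_cond_exp (F r) (M t) (M r)].

Definition markov_process F (P : R -> R -> R.-pker R ~> R) X : Prop :=
  adapted F X /\
  forall r t f, 0 <= r -> r <= t -> bounded_borel f ->
    is_cond_exp (F r) (fun w => f (X t w)) (fun w => pairing (P r t (X r w)) f).

Definition martingale_problem F (A : R -> (R -> R) -> R -> R) X : Prop :=
  forall f, bounded_C1 f ->
    martingale F (fun t w => f (X t w) - f (X 0 w)
      - \int[@lebesgue_measure R]_(s in `[0, t]) A s f (X s w)).

End processes.

(* Main.v *)
Require Import Defs.
From HB Require Import structures.
From mathcomp Require Import all_boot all_order all_algebra.
From mathcomp Require Import all_classical all_reals all_analysis measurable_realfun.
From mathcomp Require Import ring lra.

Set Implicit Arguments.
Unset Strict Implicit.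
Unset Printing Implicit Defensive.
Import Order.TTheory GRing.Theory Num.Theory.
Import numFieldNormedType.Exports.
Local Open Scope classical_set_scope.
Local Open Scope ring_scope.

(** Fix an event B of F_r and write nu_t for the law of X_t restricted to B, a
    finite measure on the half-line. Testing the martingale property of M(f)
    between r and t on B says exactly that nu solves the integrated forward
    equation

      <nu_t, f> = <nu_r, f> + int_r^t <nu_s, A_s f> ds   for all f in bC1,

    whereas the Markov property between r and t says that nu_t is the mixture
    nu_r P_{r,t} of the transition kernels. The theorem therefore reduces to the
    claim that nu_r P_{r,t} is the unique solution of the forward equation started
    from nu_r.

    Existence ([mild_integrated], then [transition_flow]). The kernels are given by
    the mild equation, in which the drift is solved exactly by the maps T_c and jumps
    are a perturbation. The mild equation can be restarted at any intermediate time
    ([mild_restart]); over a short interval of length delta it therefore reproduces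
    the forward equation up to an error of order delta^2, the drift term being
    treated with the fundamental theorem of calculus along a trajectory stopped at
    the origin ([drift_FTC]). A function whose increments are of second order is
    constant ([quadratic_const]), so the forward equation holds exactly.

    Uniqueness ([flow_unique]). For a C2 test function psi that vanishes up to
    some b >= 0, T_c psi is a translate of psi and again smooth, and along
    s |-> <nu_s, T_{t-s} psi> the drift disappears: the same second-order argument
    gives [integrated_transport]. Letting psi increase to the indicator of a
    half-line gives an equation for the tails nu_t(]b, oo[) alone, since
    T_c 1_{]b, oo[} = 1_{]b+c, oo[} and the tails of a convolution are averages of
    tails. This system is a contraction for a supremum norm with an exponential
    weight in time.

    To make sense of all these integrals one has to know that s |-> mu_s^q and
    (s, x) |-> P_{r,s}(x, .) are kernels. The families mu_s and P_{r,s}(x, .) are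
    right-continuous in s when tested against the functions psi, hence jointly
    measurable ([measurable_right_continuous]); half-lines generate the Borel sets,
    and convolutions and mixtures of kernels are kernels. *)

(** * Bounded measurable functions and kernels *)

Section bounded_measurable.
Context {d} {T : measurableType d} {R : realType}.
Implicit Types (f g : T -> R) (m : {measure set T -> \bar R}).

Definition bmeas f : Prop :=
  measurable_fun setT f /\ exists M, forall x, `|f x| <= M.

Lemma bmeas_cst (c : R) : bmeas (fun _ => c).
Proof. by split; [exact: measurable_cst|exists `|c|]. Qed.

Lemma bmeasD f g : bmeas f -> bmeas g -> bmeas (fun x => f x + g x).
Proof.
move=> [mf [M fM]] [mg [N gN]]; split; first exact: measurable_funD.
by exists (M + N) => x; rewrite (le_trans (ler_normD _ _))// lerD.
Qed.

Lemma bmeasM f g : bmeas f -> bmeas g -> bmeas (fun x => f x * g x).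
Proof.
move=> [mf [M fM]] [mg [N gN]]; split; first exact: measurable_funM.
by exists (M * N) => x; rewrite normrM ler_pM.
Qed.

Lemma bmeasZ f (c : R) : bmeas f -> bmeas (fun x => c * f x).
Proof. by move=> bf; apply: bmeasM => //; exact: bmeas_cst. Qed.

Lemma bmeasN f : bmeas f -> bmeas (fun x => - f x).
Proof.
by move=> bf; rewrite (_ : (fun _ => _) = fun x => -1 * f x);
  [exact: bmeasZ|apply/funext => x; rewrite mulN1r].
Qed.

Lemma bmeasB f g : bmeas f -> bmeas g -> bmeas (fun x => f x - g x).
Proof. by move=> bf bg; apply: bmeasD => //; exact: bmeasN. Qed.

Lemma bmeas_norm f : bmeas f -> bmeas (fun x => `|f x|).
Proof.
move=> [mf [M fM]]; split; first exact: measurableT_comp.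
by exists M => x; rewrite normr_id.
Qed.

Lemma bmeas_indic A : measurable A -> bmeas (\1_A : T -> R).
Proof.
move=> mA; split; first exact: measurable_indic.
by exists 1 => x; rewrite indicE; case: (_ \in _); rewrite ?normr1 ?normr0.
Qed.

Lemma bmeas_integrable m D f : measurable D -> (m setT < +oo)%E -> bmeas f ->
  m.-integrable D (EFin \o f).
Proof.
move=> mD moo [mf [M fM]].
apply: (@integrableS _ _ _ _ setT) => //; apply: measurable_bounded_integrable => //.
exists M; split; first exact: num_real.
by move=> y My x _ /=; rewrite (le_trans (fM x))// ltW.
Qed.

End bounded_measurable.
Arguments bmeas {d T R} f.

Lemma bmeas_comp d d' (T : measurableType d) (T' : measurableType d')
    (R : realType) (f : T' -> R) (g : T -> T') :
  bmeas f -> measurable_fun setT g -> bmeas (fun x => f (g x)).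
Proof.
move=> [mf [M fM]] mg; split; first exact: measurableT_comp.
by exists M => x.
Qed.

Section integral_bounded.
Context {d} {T : measurableType d} {R : realType}.
Variables (m : {measure set T -> \bar R}) (moo : (m setT < +oo)%E).
Implicit Types f g : T -> R.

Lemma RintD f g : bmeas f -> bmeas g ->
  \int[m]_x (f x + g x) = \int[m]_x f x + \int[m]_x g x.
Proof. by move=> bf bg; rewrite RintegralD//; exact: bmeas_integrable. Qed.

Lemma RintB f g : bmeas f -> bmeas g ->
  \int[m]_x (f x - g x) = \int[m]_x f x - \int[m]_x g x.
Proof. by move=> bf bg; rewrite RintegralB//; exact: bmeas_integrable. Qed.

Lemma RintZ c f : bmeas f -> \int[m]_x (c * f x) = c * \int[m]_x f x.
Proof. by move=> bf; rewrite RintegralZl//; exact: bmeas_integrable. Qed.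

Lemma RintEFin f : bmeas f -> (\int[m]_x (f x)%:E)%E = (\int[m]_x f x)%:E.
Proof.
move=> bf; rewrite /Rintegral fineK//; apply: integrable_fin_num => //.
exact: bmeas_integrable.
Qed.

Lemma Rint_indic (U : set T) : measurable U -> \int[m]_x (\1_U x) = fine (m U).
Proof. by move=> mU; rewrite /Rintegral integral_indic// setIT. Qed.

Lemma Rint_le f g : bmeas f -> bmeas g -> (forall x, f x <= g x) ->
  \int[m]_x f x <= \int[m]_x g x.
Proof. by move=> bf bg fg; apply: le_Rintegral => //; exact: bmeas_integrable. Qed.

Lemma Rint_cvg (f_ : nat -> T -> R) f M :
  (forall n, measurable_fun setT (f_ n)) -> bmeas f ->
  (forall n x, `|f_ n x| <= M) -> (forall x, f_ n x @[n --> \oo] --> f x) ->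
  \int[m]_x f_ n x @[n --> \oo] --> \int[m]_x f x.
Proof.
move=> mf_ bf f_M f_f.
have bf_ n : bmeas (f_ n) by split => //; exists M.
have [] := @dominated_convergence _ _ _ m setT measurableT
  (fun n => EFin \o f_ n) (EFin \o f) (cst M%:E).
- by move=> n; apply/measurable_EFinP.
- by apply/measurable_EFinP; case: bf.
- apply: aeW => x _; apply: cvg_EFin; last exact: f_f.
  by apply: nearW.
- apply: (@bmeas_integrable _ _ _ m setT (cst M)) => //; exact: bmeas_cst.
- by apply: aeW => x n _ /=; rewrite lee_fin.
move=> _ _ h; apply: fine_cvg.
by rewrite -RintEFin.
Qed.

End integral_bounded.

Section integral_subprob.
Context {d} {T : measurableType d} {R : realType}.
Variables (m : {measure set T -> \bar R}).

Lemma le1_lty : (m setT <= 1)%E -> (m setT < +oo)%E.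
Proof. by move=> /le_lt_trans; apply; rewrite ltry. Qed.

Hypothesis m1 : (m setT <= 1)%E.

Lemma Rint_bound f M : bmeas f -> 0 <= M -> (forall x, `|f x| <= M) ->
  `|\int[m]_x f x| <= M.
Proof.
move=> bf M0 fM; have moo := le1_lty m1.
apply: (le_trans (le_normr_Rintegral _ _)) => //; first exact: bmeas_integrable.
apply: (@le_trans _ _ (\int[m]_x M)).
  by apply: Rint_le => //; [exact: bmeas_norm|exact: bmeas_cst].
rewrite Rintegral_cst// ler_piMr// -lee_fin fineK//.
by rewrite ge0_fin_numE.
Qed.

End integral_subprob.

Section kernels.
Context {d1 d2} {T1 : measurableType d1} {T2 : measurableType d2} {R : realType}.

(** Kernels with masses at most 1, as a property of a family of measures: the
    families met below are given as measures, and their measurability is a theorem. *)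
Definition subker (k : T1 -> {measure set T2 -> \bar R}) : Prop :=
  (forall U, measurable U -> measurable_fun setT (k ^~ U)) /\
  forall x, (k x setT <= 1)%E.

(** Bridge to the structured kernels, for which integrals are known to be
    measurable functions of the parameter. *)
Lemma subker_spker k : subker k ->
  exists k' : R.-spker T1 ~> T2, (k' : T1 -> _) = k.
Proof.
move=> [mk k1].
pose K1 := isKernel.Build _ _ _ _ _ k mk.
pose k' : R.-ker T1 ~> T2 := HB.pack k K1.
have k'1 : (ereal_sup [set k' x [set: T2] | x in [set: T1]] <= 1)%E.
  by apply: ge_ereal_sup => _ /= [z _ <-]; exact: k1.
pose K2 := Kernel_isSubProbability.Build _ _ _ _ _ (Kernel.sort k') k'1.
pose k'' : R.-spker T1 ~> T2 := HB.pack k K1 K2.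
by exists k''.
Qed.

Lemma spker_subker (k : R.-spker T1 ~> T2) : subker k.
Proof. by split => [U|x]; [exact: measurable_kernel|exact: sprob_kernel_le1]. Qed.

Lemma subker_bmeas k (F : T1 * T2 -> R) : subker k -> bmeas F ->
  bmeas (fun s => \int[k s]_y F (s, y)).
Proof.
move=> kk [mF [M FM]]; have k1 x := kk.2 x.
have M0 (x : T1) : 0 <= M by rewrite (le_trans _ (FM (x, point))).
have bFx (s : T1) : bmeas (fun y => F (s, y)).
  by split; [exact: measurableT_comp|exists M].
have [k' k'E] := subker_spker kk.
(* Shifting by the bound M reduces to nonnegative integrands. *)
split; last first.
  by exists M => x; apply: Rint_bound => //; exact: M0.
apply: (eq_measurable_fun (fun s => \int[k' s]_y (F (s, y) + M) - \int[k' s]_y M)).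
  move=> s _; rewrite k'E RintD ?addrK//; [exact: le1_lty|exact: bmeas_cst].
apply: measurable_funB.
  apply: measurableT_comp => //.
  apply: (measurable_fun_integral_finite_kernel (fun z => (F z + M)%:E) k').
    by move=> z; rewrite lee_fin -lerBlDr sub0r; have /ler_normlP[] := FM z;
      rewrite lerNl.
  by apply/measurable_EFinP/measurable_funD.
apply: (eq_measurable_fun (fun s => M * fine (k' s setT))).
  by move=> s _; rewrite Rintegral_cst.
apply: measurable_funM => //; apply: measurableT_comp => //.
exact: measurable_kernel.
Qed.

End kernels.

Lemma Rint_fubini {d1 d2} {T1 : measurableType d1} {T2 : measurableType d2}
    {R : realType} (m1 : {measure set T1 -> \bar R})
    (m2 : {measure set T2 -> \bar R}) (F : T1 * T2 -> R) :
  (m1 setT < +oo)%E -> (m2 setT < +oo)%E -> bmeas F ->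
  \int[m1]_x \int[m2]_y F (x, y) = \int[m2]_y \int[m1]_x F (x, y).
Proof.
move=> m1oo m2oo [mF [M FM]].
(* Restricting to the whole space packs a finite measure into the structure that
   the Fubini theorem expects. *)
pose n1 : {finite_measure set T1 -> \bar R} := mfrestr measurableT m1oo.
pose n2 : {finite_measure set T2 -> \bar R} := mfrestr measurableT m2oo.
have E1 (f : T1 -> \bar R) : (\int[m1]_x f x = \int[n1]_x f x)%E.
  by apply: eq_measure_integral => A mA _; rewrite /n1/= /mfrestr /mrestr setIT.
have E2 (f : T2 -> \bar R) : (\int[m2]_x f x = \int[n2]_x f x)%E.
  by apply: eq_measure_integral => A mA _; rewrite /n2/= /mfrestr /mrestr setIT.
have b1 x : bmeas (fun y => F (x, y)).
  by split; [exact: measurableT_comp|exists M].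
have b2 y : bmeas (fun x => F (x, y)).
  by split; [exact: measurableT_comp|exists M].
have iF : ((n1 \x n2)%E).-integrable setT (EFin \o F).
  apply: bmeas_integrable => //; last by split => //; exists M.
  rewrite -setXTT [ltLHS]product_measure1E// lte_mul_pinfty//.
  - exact: fin_num_measure.
  - by rewrite -ge0_fin_numE//; exact: fin_num_measure.
have := @Fubini _ _ _ _ _ n1 n2 (EFin \o F) iF.
rewrite /Rintegral => h; congr fine.
transitivity (\int[n1]_x \int[n2]_y (EFin \o F) (x, y))%E.
  by rewrite E1; apply: eq_integral => x _; rewrite -[RHS]E2 RintEFin.
by rewrite h E2; apply: eq_integral => y _; rewrite -E1 RintEFin.
Qed.

(** * Integrals over time intervals *)

Section interval_integral.
Context {R : realType}.
Notation leb := (@lebesgue_measure R).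
Implicit Types (g : R -> R) (s t r : R).

Definition tint g s t : R := \int[leb]_(v in `[s, t]) g v.

Lemma leb_itv_lty s t : (leb `[s, t]%classic < +oo)%E.
Proof. by rewrite lebesgue_measure_itv/=; case: ifP; rewrite ltry. Qed.

(** Lebesgue measure on [s, t] as a finite measure on the line, so that time
    integrals fall under the lemmas on finite measures. *)
Definition leb_on s t : {measure set (measurableTypeR R) -> \bar R} :=
  mrestr leb (measurable_itv `[s, t]).

Lemma leb_on_lty s t : (leb_on s t setT < +oo)%E.
Proof. by rewrite /leb_on/= /mrestr setTI leb_itv_lty. Qed.

Lemma bmeas_itv_integrable g s t : bmeas g -> leb.-integrable `[s, t] (EFin \o g).
Proof.
move=> [mg [M gM]]; apply: measurable_bounded_integrable => //.
- exact: leb_itv_lty.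
- exact: measurable_funS mg.
exists M; split; first exact: num_real.
by move=> y My x _ /=; rewrite (le_trans (gM x))// ltW.
Qed.

Lemma tintE g s t : bmeas g -> tint g s t = \int[leb_on s t]_v g v.
Proof.
move=> bg; rewrite /tint /Rintegral; congr fine.
rewrite (@negligible_integral _ _ _ (leb_on s t) setT (~` `[s, t])) //.
- rewrite setTD setCK; apply: eq_measure_integral => A mA Ast.
  by rewrite /= /mrestr setIidl.
- exact: measurableC.
- by apply: bmeas_integrable => //; exact: leb_on_lty.
- by rewrite /= /mrestr setICl measure0.
Qed.

Lemma tint_fubini d (T : measurableType d) (m : {measure set T -> \bar R})
    (F : R * T -> R) s t : (m setT < +oo)%E -> bmeas F ->
  bmeas (fun v => \int[m]_y F (v, y)) ->
  tint (fun v => \int[m]_y F (v, y)) s t = \int[m]_y tint (fun v => F (v, y)) s t.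
Proof.
move=> moo bF bI; rewrite tintE//.
have bFy y : bmeas (fun v => F (v, y)).
  by apply: (bmeas_comp bF); exact: pair2_measurable.
under [RHS]eq_Rintegral do rewrite tintE//.
exact: (@Rint_fubini _ _ (measurableTypeR R) T R (leb_on s t) m F
  (leb_on_lty s t) moo bF).
Qed.

Lemma tint_cat g r s t : r <= s -> s <= t -> leb.-integrable `[r, t] (EFin \o g) ->
  tint g r t = tint g r s + tint g s t.
Proof.
move=> rs st ig; rewrite /tint.
have ig' : leb.-integrable `]s, t] (EFin \o g).
  by apply: integrableS ig => //; apply: subset_itvr; rewrite bnd_simp.
have := @Rintegral_itvB R g (BLeft r) (BRight t) s ig.
by rewrite !bnd_simp => /(_ rs st); rewrite (Rintegral_itv_obnd_cbnd ig') => <-;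
  rewrite addrC subrK.
Qed.

Lemma eq_tint g h s t : (forall v, s <= v <= t -> g v = h v) ->
  tint g s t = tint h s t.
Proof. by move=> gh; apply: eq_Rintegral => v; rewrite inE/= in_itv/=; exact: gh. Qed.

Lemma tint_le g h s t : leb.-integrable `[s, t] (EFin \o g) ->
  leb.-integrable `[s, t] (EFin \o h) ->
  (forall v, s <= v <= t -> g v <= h v) -> tint g s t <= tint h s t.
Proof.
by move=> ig ih gh; apply: le_Rintegral => // v/=; rewrite in_itv/=; exact: gh.
Qed.

Lemma tint_cst c s t : s <= t -> tint (fun _ => c) s t = c * (t - s).
Proof.
move=> st; rewrite /tint Rintegral_cst//; congr (_ * _).
transitivity (fine (leb `[s, t]%classic)); first by [].
rewrite lebesgue_measure_itv/= lte_fin; case: ltP => //= ts.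
have -> : s = t by apply/eqP; rewrite eq_le st.
by rewrite subrr.
Qed.

Lemma tint_bound g M s t : s <= t -> leb.-integrable `[s, t] (EFin \o g) ->
  (forall v, s <= v <= t -> `|g v| <= M) -> `|tint g s t| <= M * (t - s).
Proof.
move=> st ig gM; rewrite -tint_cst//.
have ic c : leb.-integrable `[s, t] (EFin \o (fun=> c)).
  by apply: bmeas_itv_integrable; exact: bmeas_cst.
rewrite ler_norml; apply/andP; split; last first.
  by apply: tint_le => // v /gM; rewrite ler_norml => /andP[].
have -> : - tint (fun=> M) s t = tint (fun=> - M) s t by rewrite !tint_cst// mulNr.
by apply: tint_le => // v /gM; rewrite ler_norml => /andP[].
Qed.

Lemma tintB g h s t : leb.-integrable `[s, t] (EFin \o g) ->
  leb.-integrable `[s, t] (EFin \o h) ->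
  tint (fun v => g v - h v) s t = tint g s t - tint h s t.
Proof. by move=> ig ih; rewrite /tint RintegralB. Qed.

Lemma tintZ c g s t : leb.-integrable `[s, t] (EFin \o g) ->
  tint (fun v => c * g v) s t = c * tint g s t.
Proof. by move=> ig; rewrite /tint RintegralZl. Qed.

Lemma tint_close g h M s t : s <= t -> leb.-integrable `[s, t] (EFin \o g) ->
  leb.-integrable `[s, t] (EFin \o h) ->
  (forall v, s <= v <= t -> `|g v - h v| <= M) ->
  `|tint g s t - tint h s t| <= M * (t - s).
Proof.
move=> st ig ih gh; rewrite -tintB//; apply: tint_bound => //.
have := @integrableB _ _ _ leb _ _ _ _ ig ih.
by apply; exact: measurable_itv.
Qed.

(** Cutting [r, t] into n pieces bounds the total increment by K (t - r)^2 / n. This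
    replaces differentiation in time, which would require continuity of the
    integrands. *)
Lemma quadratic_const (H : R -> R) K r t : r <= t ->
  (forall s s', r <= s -> s <= s' -> s' <= t -> `|H s' - H s| <= K * (s' - s) ^+ 2) ->
  H t = H r.
Proof.
move=> rt Hq.
have split_bound n : `|H t - H r| <= K * (t - r) ^+ 2 / n.+1%:R.
  pose e := (t - r) / n.+1%:R.
  have e0 : 0 <= e by rewrite divr_ge0// subr_ge0.
  have ne : n.+1%:R * e = t - r by rewrite mulrCA divff ?mulr1// pnatr_eq0.
  have step k : (k <= n.+1)%N -> `|H (r + k%:R * e) - H r| <= k%:R * (K * e ^+ 2).
    elim: k => [_|k IH kn]; first by rewrite !mul0r addr0 subrr normr0.
    rewrite (_ : _ - _ = (H (r + k.+1%:R * e) - H (r + k%:R * e)) +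
      (H (r + k%:R * e) - H r)); last by ring.
    apply: (le_trans (ler_normD _ _)).
    have -> : k.+1%:R * (K * e ^+ 2) = K * e ^+ 2 + k%:R * (K * e ^+ 2).
      by rewrite -natr1; ring.
    apply: lerD; last by apply: IH; exact: ltnW.
    have eE : e = (r + k.+1%:R * e) - (r + k%:R * e) by rewrite -natr1; ring.
    rewrite [in leRHS]eE; apply: Hq.
    - by rewrite lerDl mulr_ge0.
    - by rewrite lerD2l ler_wpM2r// ler_nat.
    - by rewrite -lerBrDl -ne ler_wpM2r// ler_nat.
  have := step n.+1 (leqnn _); rewrite ne addrCA subrr addr0 => /le_trans; apply.
  rewrite le_eqVlt; apply/orP; left; apply/eqP; rewrite -ne.
  by field; rewrite addrC natr1 pnatr_eq0.
apply/eqP; rewrite -subr_eq0 -normr_le0; apply/ler_addgt0Pr => eps eps0.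
rewrite add0r.
pose n := Num.truncn (K * (t - r) ^+ 2 / eps).
apply: (le_trans (split_bound n)).
rewrite ler_pdivrMr ?ltr0n// -ler_pdivrMl// mulrC.
exact/ltW/truncnS_gt.
Qed.

End interval_integral.

(** * Joint measurability of right-continuous families *)

Section right_continuous_measurability.
Context {d} {T : measurableType d} {R : realType}.

(** The family is the limit of its values at the grid points strictly to the right
    of the current time, and such step functions are jointly measurable. The time is
    clipped at 0 so that only nonnegative times matter. *)
Lemma measurable_right_continuous (Y : R -> T -> R) :
  (forall s, 0 <= s -> measurable_fun setT (Y s)) ->
  (forall s w, 0 <= s -> Y u w @[u --> s^'+] --> Y s w) ->
  measurable_fun setT (fun z : R * T => Y (Num.max z.1 0) z.2).
Proof.
move=> mY rY.
pose k (n : nat) (s : R) : nat := Num.truncn (n.+1%:R * Num.max s 0).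
pose h (n : nat) (z : R * T) := Y ((k n z.1).+1%:R / n.+1%:R) z.2.
apply: (@measurable_fun_cvg _ _ _ setT h) => [n|z _]; last first.
  have z0 : 0 <= Num.max z.1 0 by rewrite le_max lexx orbT.
  have /cvg_at_rightP := rY (Num.max z.1 0) z.2 z0; apply.
  have kn n : (k n z.1)%:R <= n.+1%:R * Num.max z.1 0 < (k n z.1).+1%:R.
    by apply: truncn_itv; rewrite mulr_ge0.
  split=> [n|].
    by rewrite ltr_pdivlMr// mulrC; case/andP: (kn n).
  apply/cvgrPdist_lt => e e0.
  near=> n.
  rewrite distrC ger0_norm; last first.
    by rewrite subr_ge0 ltW// ltr_pdivlMr// mulrC; case/andP: (kn n).
  rewrite ltrBlDr ltr_pdivrMr// mulrDl -natr1 [ltRHS]addrC ler_ltD//.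
    by rewrite mulrC; case/andP: (kn n).
  rewrite mulrC -ltr_pdivrMr// (@lt_trans _ _ n%:R)//; last by rewrite ltr_nat.
  by near: n; exact: nbhs_infty_gtr.
have mk : measurable_fun setT (fun z : R * T => n.+1%:R * Num.max z.1 0).
  by apply: measurable_funM => //; apply: measurable_maxr => //; exact: measurable_fst.
move=> _ B mB; rewrite setTI.
have -> : h n @^-1` B = \bigcup_j ((fun z : R * T => n.+1%:R * Num.max z.1 0) @^-1`
    `[j%:R, j.+1%:R[ `&` (setT `*` (Y (j.+1%:R / n.+1%:R) @^-1` B))).
  apply/seteqP; split => [z Bz|z [j _ [/=]]].
    exists (k n z.1) => //; split => /=; last by split.
    by rewrite in_itv/=; apply: truncn_itv; rewrite mulr_ge0// le_max lexx orbT.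
  by rewrite in_itv/= => /truncn_def jE [_ +]; rewrite /h /k/= jE.
apply: bigcupT_measurable => j; apply: measurableI.
  by rewrite -[X in measurable X]setTI; exact: mk.
by apply: measurableX => //; rewrite -[X in measurable X]setTI; apply: mY => //.
Unshelve. all: by end_near. Qed.

End right_continuous_measurability.

(** * Measures on the line and on the half-line *)

Lemma measure_compl d (T : measurableType d) (R : realType)
    (m : {measure set T -> \bar R}) (S : set T) :
  (m setT < +oo)%E -> measurable S -> m (~` S) = (m setT - m S)%E.
Proof.
move=> moo mS; rewrite -setTD.
by have /= -> := measureD measurableT mS moo; rewrite setTI.
Qed.

Section tails.
Context {R : realType}.

Definition tail (b : R) : set R := `]b, +oo[%classic.

Lemma measurable_tail b : measurable (tail b).
Proof. exact: measurable_itv. Qed.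

(** The half-lines are a pi-system generating the Borel sets. *)
Lemma tail_induction (Q : set (set R)) :
  Q setT -> (forall b, Q (tail b)) ->
  (forall S, measurable S -> Q S -> Q (~` S)) ->
  (forall F : (set R)^nat, (forall n, measurable (F n)) -> trivIset setT F ->
     (forall n, Q (F n)) -> Q (\bigcup_k F k)) ->
  forall S, measurable S -> Q S.
Proof.
move=> QT Qt QC QU S mS.
have E : @measurable _ R = <<s @RGenOInfty.G R >> := RGenOInfty.measurableE R.
apply: (@dynkin_induction _ R (@RGenOInfty.G R)) => //; last by rewrite -E.
- move=> _ _ [x ->] [y ->]; exists (Num.max x y).
  by apply/seteqP; split => z/=; rewrite !in_itv/= !andbT gt_max => /andP.
- by move=> _ [x ->]; exact: Qt.
Qed.

Lemma tail_measurable d (T : measurableType d) (k : T -> {measure set R -> \bar R}) :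
  (forall x, (k x setT < +oo)%E) -> measurable_fun setT (k ^~ setT) ->
  (forall b, measurable_fun setT (k ^~ (tail b))) ->
  forall U, measurable U -> measurable_fun setT (k ^~ U).
Proof.
move=> koo kT kt; apply: tail_induction => //.
- move=> S mS kS.
  apply: (eq_measurable_fun (fun x => k x setT - k x S)%E).
    by move=> x _; rewrite measure_compl.
  exact: emeasurable_funB.
- move=> F mF tF kF.
  apply: (eq_measurable_fun (fun x => \sum_(0 <= i <oo) k x (F i))%E).
    by move=> x _; rewrite measure_semi_bigcup//; exact: bigcup_measurable.
  exact: ge0_emeasurable_sum.
Qed.

Lemma tail_unique (m1 m2 : {measure set R -> \bar R}) :
  (m1 setT < +oo)%E -> m1 setT = m2 setT -> (forall b, m1 (tail b) = m2 (tail b)) ->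
  forall U, measurable U -> m1 U = m2 U.
Proof.
move=> oo ET Et; apply: tail_induction => //.
- by move=> S mS ES; rewrite !measure_compl -?ET// ES.
- by move=> F mF tF EF; rewrite !measure_semi_bigcup//;
    [exact: eq_eseriesr|exact: bigcup_measurable..].
Qed.

End tails.

Section concentrated.
Context {R : realType}.
Implicit Types (m : {measure set R -> \bar R}) (f : R -> R).

Definition conc m : Prop := m (~` Rp) = 0%E.

Lemma measurable_Rp : measurable (@Rp R).
Proof. exact: measurable_itv. Qed.

Lemma on_Rp_conc m : m setT = 1%E -> on_Rp m -> conc m.
Proof.
move=> m1 mRp; rewrite /conc measure_compl ?m1 ?ltry//; last exact: measurable_Rp.
by rewrite (mRp : m Rp = 1%E) subee.
Qed.

Lemma conc_Rint m f : (m setT < +oo)%E -> conc m -> bmeas f ->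
  \int[m]_x f x = \int[m]_(x in Rp) f x.
Proof.
move=> moo cm bf; rewrite /Rintegral (@negligible_integral _ _ _ m setT (~` Rp)) //.
- by rewrite setTD setCK.
- by apply: measurableC; exact: measurable_Rp.
- exact: bmeas_integrable.
Qed.

Lemma conc_eq_Rint m f g : (m setT < +oo)%E -> conc m -> bmeas f -> bmeas g ->
  (forall x, 0 <= x -> f x = g x) -> \int[m]_x f x = \int[m]_x g x.
Proof.
move=> moo cm bf bg fg; rewrite !conc_Rint//; apply: eq_Rintegral => x.
by rewrite inE /Rp/= in_itv/= andbT; exact: fg.
Qed.

End concentrated.

Section mixing.
Context {d} {T : measurableType d} {R : realType}.

(** Averaging a kernel over a random parameter [w] gives a flow of measures; it is
    used with [w] an outcome in an event, to form restricted laws. *)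
Lemma mixture_kernel (l : {measure set T -> \bar R})
    (k : R * T -> {measure set R -> \bar R}) :
  (l setT <= 1)%E -> subker k ->
  exists nu : R -> {measure set R -> \bar R}, subker nu /\
    forall h s, bmeas h -> \int[nu s]_x h x = \int[l]_w \int[k (s, w)]_y h y.
Proof.
move=> l1 kk.
have sl : subker (fun _ : R => l) by split => // U mU; exact: measurable_cst.
have [l' l'E] := subker_spker sl.
have [k' k'E] := subker_spker kk.
have nuT s : ((l' \; k')%E s setT <= 1)%E.
  rewrite /mkcomp/= /kcomp (@le_trans _ _ (\int[l' s]__ 1)%E)//.
    apply: ge0_le_integral => //.
    - apply: measurableT_comp (measurable_kernel k' _ measurableT) _ => //.
    - by move=> y _; exact: sprob_kernel_le1.
  by rewrite integral_cst// mul1e; exact: sprob_kernel_le1.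
exists (l' \; k')%E; split.
  by split => // U mU; exact: measurable_kernel.
move=> h s [mh [M hM]].
have M0 : 0 <= M by rewrite (le_trans _ (hM 0)).
have bh : bmeas h by split => //; exists M.
have bc : bmeas (fun _ : R => M) by exact: bmeas_cst.
have bhM : bmeas (fun x => h x + M) by exact: bmeasD.
have bk f : bmeas f -> bmeas (fun w => \int[k (s, w)]_y f y).
  move=> bf; have := @subker_bmeas _ _ _ _ _ k (fun z => f z.2) kk.
  by move=> /(_ (bmeas_comp bf measurable_snd)) /bmeas_comp; exact.
have key f : bmeas f -> (forall x, 0 <= f x) ->
    \int[(l' \; k')%E s]_x f x = \int[l]_w \int[k (s, w)]_y f y.
  move=> bf f0; rewrite /Rintegral; congr fine.
  transitivity (\int[(l' : R -> {measure set T -> \bar R}) s]_w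
      \int[(k' : R * T -> {measure set R -> \bar R}) (s, w)]_y (f y)%:E)%E.
    apply: (@integral_kcomp _ _ _ _ _ _ _ l' k' s (fun x => (f x)%:E)).
      by move=> z; rewrite lee_fin.
    by apply/measurable_EFinP; case: bf.
  rewrite l'E k'E; apply: eq_integral => w _.
  by rewrite RintEFin//; apply: le1_lty; exact: kk.2.
have -> : h = fun x => (h x + M) - M by apply/funext => x; rewrite addrK.
rewrite RintB//; last exact/le1_lty/nuT.
rewrite !key//; last first.
  by move=> x; rewrite -lerBlDr sub0r; have /ler_normlP[] := hM x; rewrite lerNl.
rewrite -RintB//; last 3 first.
- exact: le1_lty.
- exact: bk.
- exact: bk.
by apply: eq_Rintegral => w _; rewrite -RintB//; apply: le1_lty; exact: kk.2.
Qed.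

End mixing.


(** * Convolution kernels *)

Section convolution_kernels.
Context {R : realType}.
Implicit Types (m : probability R R).

Lemma Rint_convol (m1 : {measure set R -> \bar R}) (m2 : probability R R)
    (h : R -> R) : (m1 setT < +oo)%E -> bmeas h ->
  \int[convol m1 m2]_x h x = \int[m1]_x \int[m2]_z h (x + z).
Proof.
move=> m1oo bh.
have m2oo : (m2 setT < +oo)%E by rewrite probability_setT ltry.
pose n1 : {finite_measure set R -> \bar R} := mfrestr measurableT m1oo.
have E1 (f : R -> \bar R) : (\int[m1]_x f x = \int[n1]_x f x)%E.
  by apply: eq_measure_integral => A mA _; rewrite /n1/= /mfrestr /mrestr setIT.
have bF : bmeas (fun p : R * R => h (addp p)).
  by apply: (bmeas_comp bh); exact: measurable_addp.
have iF : ((n1 \x m2)%E).-integrable setT (fun p : R * R => (h (addp p))%:E).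
  apply: (bmeas_integrable _ _ bF) => //.
  rewrite -setXTT [ltLHS]product_measure1E// lte_mul_pinfty//.
  exact: fin_num_measure.
rewrite /Rintegral; congr fine.
transitivity (\int[pushforward (n1 \x m2) addp]_x (h x)%:E)%E.
  apply: eq_measure_integral => A mA _; rewrite /= /convol /pushforward.
  by rewrite /product_measure1/=; exact: E1.
rewrite (integral_pushforward _ _ iF)//; last first.
  by apply/measurable_EFinP; case: bh.
rewrite preimage_setT.
have := @integral12_prod_meas1 _ _ _ _ _ n1 m2 _ iF.
rewrite /fubini_F => <-; rewrite E1; apply: eq_integral => x _.
rewrite -(@RintEFin _ _ _ m2 m2oo (fun z => h (x + z)))//.
by apply: (bmeas_comp bh); exact: measurable_funD.
Qed.

Lemma convol_lty (m1 : {measure set R -> \bar R}) (m2 : probability R R) :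
  (m1 setT < +oo)%E -> (convol m1 m2 setT < +oo)%E.
Proof.
move=> m1oo; rewrite /convol /pushforward preimage_setT -setXTT.
rewrite product_measure1E// [X in (_ * X)%E](_ : _ = 1%E) ?mule1//.
exact: probability_setT.
Qed.

Lemma convolE (m1 : {measure set R -> \bar R}) (m2 : probability R R) U :
  (m1 setT < +oo)%E -> measurable U ->
  convol m1 m2 U = (\int[m1]_x \int[m2]_z \1_U (x + z))%:E.
Proof.
move=> m1oo mU; rewrite -Rint_convol//; last exact: bmeas_indic.
rewrite Rint_indic// fineK// ge0_fin_numE//.
apply: (@le_lt_trans _ _ (convol m1 m2 setT)); first by rewrite le_measure ?inE.
rewrite convol_lty//.
Qed.

Lemma probability_subker d (T : measurableType d) (k : T -> probability R R) :
  (forall U, measurable U -> measurable_fun setT (k ^~ U)) -> subker k.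
Proof. by move=> mk; split => // x; exact: sprobability_setT. Qed.

Context {d} {T : measurableType d}.

Lemma subker_convol (k l : T -> probability R R) : subker k -> subker l ->
  subker (fun s => convol (k s) (l s)).
Proof.
move=> kk kl; apply: probability_subker => U mU.
apply: (eq_measurable_fun
    (fun s => (\int[k s]_x \int[l s]_z \1_U (x + z))%:E)).
  by move=> s _; apply/esym/convolE => //; exact: le1_lty (kk.2 s).
apply/measurable_EFinP.
have kl' : subker (fun p : T * R => l p.1).
  split => [V mV|p]; last exact: kl.2.
  by apply: measurableT_comp (kl.1 _ mV) _; exact: measurable_fst.
have b1 : bmeas (fun p : T * R => \int[l p.1]_z \1_U (p.2 + z)).
  have := @subker_bmeas _ _ _ _ _ _ (fun q : (T * R) * R => \1_U (q.1.2 + q.2)) kl'.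
  apply; apply: (bmeas_comp (bmeas_indic mU)).
  apply: measurable_funD => //.
  by apply: measurableT_comp measurable_snd _; exact: measurable_fst.
by have [] := subker_bmeas kk b1.
Qed.

Lemma subker_convol_pow (k : T -> probability R R) i : subker k ->
  subker (fun s => convol_pow (k s) i).
Proof.
move=> kk; elim: i => [|i IH] /=; last exact: subker_convol.
by apply: probability_subker => U mU; exact: measurable_cst.
Qed.

Lemma subker_convol_mix (q : posdist R) (k : T -> probability R R) : subker k ->
  subker (fun s => convol_mix q (k s)).
Proof.
move=> kk; apply: probability_subker => U mU.
pose h (i : nat) s := (((q i)%:num)%:E * convol_pow (k s) i U)%E.
apply: (eq_measurable_fun
    (fun s => \sum_(0 <= i <oo | i \in [pred i : nat | (1 <= i)%N]) h i s)%E).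
  by move=> s _; rewrite -(eseries_cond (h ^~ s) xpredT 1).
apply: ge0_emeasurable_sum => i.
  by move=> s _ _; rewrite mule_ge0// lee_fin.
move=> _; apply: emeasurable_funM; first exact: measurable_cst.
by have [+ _] := subker_convol_pow i kk; apply.
Qed.

Lemma conc_convol (m1 : {measure set R -> \bar R}) (m2 : probability R R) :
  (m1 setT < +oo)%E -> conc m1 -> conc m2 -> conc (convol m1 m2).
Proof.
move=> m1oo c1 c2; rewrite /conc.
rewrite [LHS](convolE m2 m1oo (measurableC measurable_Rp)).
have bI : bmeas (\1_(~` @Rp R) : R -> R).
  by apply: bmeas_indic; apply: measurableC; exact: measurable_Rp.
have m2oo : (m2 setT < +oo)%E by rewrite probability_setT ltry.
have sm2 : subker (fun _ : R => m2).
  by apply: probability_subker => U mU; exact: measurable_cst.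
rewrite (@conc_eq_Rint _ _ _ (fun _ => 0))//.
- by rewrite Rintegral_cst// mul0r.
- apply: (@subker_bmeas _ _ _ _ _ _ (fun q : R * R => \1_(~` @Rp R) (q.1 + q.2)) sm2).
  by apply: (bmeas_comp bI); exact: measurable_addp.
- exact: bmeas_cst.
move=> x x0; rewrite (@conc_eq_Rint _ _ _ (fun _ => 0))//.
- by rewrite Rintegral_cst// mul0r.
- by apply: (bmeas_comp bI); exact: measurable_funD.
- exact: bmeas_cst.
move=> z z0; rewrite indicE memNset//= /Rp/= in_itv/= andbT.
by apply; rewrite addr_ge0.
Qed.

Lemma conc_convol_mix (q : posdist R) (m : probability R R) : conc m ->
  conc (convol_mix q m).
Proof.
move=> cm; rewrite /conc.
transitivity (\sum_(1 <= i <oo)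
  (((q i)%:num)%:E * convol_pow m i (~` Rp)))%E; first by [].
apply: eseries0 => i _ _; rewrite (_ : convol_pow m i (~` Rp) = 0%E) ?mule0//.
elim: i => [|i IH]; last first.
  by apply: conc_convol => //; apply: le1_lty; exact: sprobability_setT.
by rewrite /= /dirac indicE memNset//= /Rp/= in_itv/= lexx andbT; apply.
Qed.

End convolution_kernels.

(** * Calculus on the half-line *)

Section halfline_calculus.
Context {R : realType}.
Implicit Types (f : R -> R).

Lemma boundedP f : [bounded f x | x in Rp] <->
  exists M, forall x, 0 <= x -> `|f x| <= M.
Proof.
split=> [[M [_ fM]]|[M fM]].
  exists (M + 1) => x x0; apply: (fM (M + 1)); first by rewrite ltrDl.
  by rewrite /Rp/= in_itv/= andbT.
exists M; split; first exact: num_real.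
by move=> y My x; rewrite /Rp/= in_itv/= andbT => /fM/le_trans; apply; exact: ltW.
Qed.

(** Only the values of f on the half-line are meaningful; this extension is
    measurable and bounded on the whole line as soon as f is so on the half-line, and
    it equals [drift 0 f]. *)
Definition ext f : R -> R := fun x => f (Num.max x 0).

Lemma max0_ge0 (x : R) : 0 <= Num.max x 0.
Proof. by rewrite le_max lexx orbT. Qed.

Lemma max0_id (x : R) : 0 <= x -> Num.max x 0 = x.
Proof. by move=> x0; apply/max_idPl. Qed.

Lemma ext_id f x : 0 <= x -> ext f x = f x.
Proof. by move=> x0; rewrite /ext max0_id. Qed.

Lemma drift_ext c f : drift c (ext f) = drift c f.
Proof. by apply/funext => x; rewrite /drift ext_id// max0_ge0. Qed.

Lemma drift0 f : drift 0 f = ext f.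
Proof. by apply/funext => x; rewrite /drift /ext subr0. Qed.

Lemma max0B (y c : R) : 0 <= c -> Num.max (Num.max y 0 - c) 0 = Num.max (y - c) 0.
Proof.
by move=> c0; case: (lerP 0 y) => y0 //; rewrite !max_r//; lra.
Qed.

(** The maps T_c form a semigroup; stopping twice at the origin is harmless because
    the second shift is nonnegative. *)
Lemma drift_drift b c f : 0 <= c -> drift b (drift c f) = drift (b + c) f.
Proof. by move=> c0; apply/funext => x; rewrite /drift max0B// opprD addrA. Qed.

Lemma measurable_max0 : measurable_fun setT (fun x : R => Num.max x 0).
Proof. exact: measurable_maxr. Qed.

Lemma bmeas_ext f : bounded_borel f -> bmeas (ext f).
Proof.
move=> [mf /boundedP[M fM]]; split; last by exists M => x; rewrite fM// max0_ge0.
apply: (@measurable_comp _ _ _ _ _ _ Rp) => //; first exact: measurable_Rp.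
  by move=> _ [x _ <-]; rewrite /Rp/= in_itv/= andbT max0_ge0.
exact: measurable_max0.
Qed.

Lemma bmeas_bounded_borel f : bmeas f -> bounded_borel f.
Proof.
move=> [mf [M fM]]; split; first exact: measurable_funS mf.
by apply/boundedP; exists M.
Qed.

Lemma bmeas_drift c f : bmeas f -> bmeas (drift c f).
Proof.
move=> bf; apply: (bmeas_comp bf); apply: measurable_maxr => //.
exact: measurable_funB.
Qed.

Lemma ext_continuous f : {within Rp, continuous f} -> continuous (ext f).
Proof.
move=> cf x; have Rx : Rp (Num.max x 0) by rewrite /Rp/= in_itv/= andbT max0_ge0.
have /subspace_continuousP/(_ _ Rx) h := cf.
apply: (@cvg_comp _ _ _ (fun x => Num.max x 0) f _ (within Rp (nbhs (Num.max x 0)))) h.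
move=> A; rewrite /= /within/= => nA.
have c : continuous (fun x : R => Num.max x 0).
  by move=> y; apply: continuous_max => //; exact: cst_continuous.
apply: (@filterS _ (nbhs x) _ _ _ _ (c x _ nA)) => y /=; apply.
by rewrite /Rp/= in_itv/= andbT; exact: max0_ge0.
Qed.

Lemma within_Rp_dnbhs_proper (x : R) : 0 <= x -> ProperFilter (within Rp x^').
Proof.
move=> x0; apply: Build_ProperFilter_ex => A.
rewrite /within/= /dnbhs /within/= => /nbhs_ballP[e /= e0 eA].
have : A (x + e / 2).
  apply: eA.
  - rewrite /ball/= opprD addrA subrr sub0r normrN gtr0_norm ?divr_gt0//.
    by rewrite ltr_pdivrMr// ltr_pMr// ltr1n.
  - by rewrite gt_eqF// ltrDl divr_gt0.
  - by rewrite /Rp/= in_itv/= andbT addr_ge0// ltW// divr_gt0.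
by move=> Ax; exists (x + e / 2).
Qed.

Lemma has_deriv_eq f x l : 0 <= x -> has_deriv f x l -> deriv_Rp f x = l.
Proof.
move=> x0; have := within_Rp_dnbhs_proper x0 => ? h; exact: cvg_lim h.
Qed.

Lemma has_derivP f (x l : R) : has_deriv f x l <-> forall e, 0 < e ->
  exists2 r, 0 < r & forall y, 0 <= y -> y != x -> `|y - x| < r ->
    `|diff_quot f x y - l| < e.
Proof.
split=> [/cvgrPdist_lt h e e0|h].
  have := h e e0.
  move=> /nbhs_ballP[r /= r0 rP]; exists r => // y y0 yx yr.
  rewrite distrC; apply: rP => //; first by rewrite /ball/= distrC.
  by rewrite /Rp/= in_itv/= andbT.
apply/cvgrPdist_lt => e /h[r r0 rP].
suff : nbhs x [set y | y != x -> Rp y -> `|l - diff_quot f x y| < e] by [].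
apply/nbhs_ballP; exists r => //= y; rewrite /ball/= => xy yx.
rewrite /Rp/= in_itv/= andbT => y0; rewrite distrC; apply: rP => //.
by rewrite distrC.
Qed.

Lemma is_deriveP f (x l : R) : is_derive x (1 : R) f l <-> forall e, 0 < e ->
  exists2 r, 0 < r & forall y, y != x -> `|y - x| < r ->
    `|diff_quot f x y - l| < e.
Proof.
have E h : h^-1 *: ((f \o shift x) (h *: (1 : R)) - f x) = diff_quot f x (h + x).
  by rewrite /diff_quot /= [h *: _]mulr1 addrK mulrC.
split=> [[df fl] e e0|h].
  have : h^-1 *: ((f \o shift x) (h *: (1 : R)) - f x) @[h --> 0^'] --> l.
    by rewrite -fl.
  move/cvgrPdist_lt => /(_ e e0).
  move=> /nbhs_ballP[r /= r0 rP]; exists r => // y yx yr.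
  have := rP (y - x); rewrite E subrK distrC; apply; last by rewrite subr_eq0.
  by rewrite /ball/= sub0r normrN.
have c : h^-1 *: ((f \o shift x) (h *: (1 : R)) - f x) @[h --> 0^'] --> l.
  apply/cvgrPdist_lt => e /h[r r0 rP].
  suff : nbhs (0 : R) [set h | h != 0 ->
    `|l - h^-1 *: ((f \o shift x) (h *: (1 : R)) - f x)| < e] by [].
  apply/nbhs_ballP; exists r => //= y; rewrite /ball/= sub0r normrN => yr y0.
  by rewrite E distrC; apply: rP; rewrite ?addrK// -subr_eq0 addrK.
split; first by apply/cvg_ex; exists l.
exact: cvg_lim c.
Qed.

Lemma is_derive_has_deriv f (x l : R) : is_derive x (1 : R) f l -> has_deriv f x l.
Proof.
move=> /is_deriveP h; apply/has_derivP => e /h[r r0 rP].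
by exists r => // y _; exact: rP.
Qed.

Lemma has_deriv_is_derive f (x l : R) : 0 < x -> has_deriv f x l ->
  is_derive x (1 : R) (ext f) l.
Proof.
move=> x0 /has_derivP h; apply/is_deriveP => e /h[r r0 rP].
exists (Num.min r x); first by rewrite lt_min r0.
move=> y yx; rewrite lt_min => /andP[yr]; rewrite ltr_norml => /andP[y0 _].
have {}y0 : 0 <= y by move: y0; lra.
by rewrite /diff_quot !ext_id// ?(ltW x0)//; exact: rP.
Qed.

(** Minus the generator of the semigroup T: it vanishes at the origin, where the
    drift stops, even if the one-sided derivative does not. *)
Definition Dr f : R -> R := fun x => deriv_Rp f x * \1_(`]0, +oo[) x.

Lemma bounded_C1_borel f : bounded_C1 f -> bounded_borel f.
Proof.
move=> [[cf bf] _ _ _]; split => //.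
by apply: subspace_continuous_measurable_fun => //; exact: measurable_Rp.
Qed.

Lemma Dr_pos f x : 0 < x -> Dr f x = deriv_Rp f x.
Proof. by move=> x0; rewrite /Dr indicE mem_set ?mulr1//= in_itv/= x0. Qed.

Lemma Dr_le0 f x : x <= 0 -> Dr f x = 0.
Proof.
move=> x0; rewrite /Dr indicE memNset ?mulr0//= in_itv/= andbT.
by apply/negP; rewrite -leNgt.
Qed.

Lemma bmeas_Dr f : bounded_C1 f -> bmeas (Dr f).
Proof.
move=> [_ _ cd bd].
have -> : Dr f = fun x => ext (deriv_Rp f) x * \1_(`]0, +oo[) x.
  apply/funext => x; have [x0|x0] := leP x 0; last by rewrite /Dr ext_id// ltW.
  by rewrite Dr_le0// indicE memNset ?mulr0//= in_itv/= andbT; apply/negP; rewrite -leNgt.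
apply: bmeasM; last exact: bmeas_indic.
apply: bmeas_ext; split => //.
by apply: subspace_continuous_measurable_fun => //; exact: measurable_Rp.
Qed.

End halfline_calculus.

(** * The fundamental theorem of calculus along the drift *)

Section drift_FTC.
Context {R : realType}.
Implicit Types (f : R -> R) (s t v y : R).

Lemma tint0 s t : tint (fun _ => 0 : R) s t = 0.
Proof. by rewrite /tint Rintegral_cst// mul0r. Qed.

Lemma tint_point (g : R -> R) t : tint g t t = 0.
Proof. by rewrite /tint set_itv1 Rintegral_set1. Qed.

(** T moves y along the trajectory [v |-> y - (v - s)], stopped at the origin; this
    integrates the derivative of f along it. *)
Lemma drift_FTC f s t y : bounded_C1 f -> s <= t ->
  drift (t - s) f y - ext f y = - tint (fun v => drift (v - s) (Dr f) y) s t.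
Proof.
move=> fC1; have [[cf _] df cd _] := fC1.
have stopped v : y - (v - s) <= 0 -> drift (v - s) (Dr f) y = 0.
  by move=> h; rewrite /drift max_r// Dr_le0.
rewrite le_eqVlt => /predU1P[<-|st].
  by rewrite subrr drift0 subrr tint_point oppr0.
have [y0|y0] := leP y 0.
  rewrite (@eq_tint _ _ (fun _ => 0)) ?tint0; last first.
    by move=> v /andP[sv _]; apply: stopped; lra.
  by rewrite /drift /ext !max_r ?subrr ?oppr0//; lra.
(* Before the origin is reached the integrand is a continuous derivative, except
   possibly at the endpoint, which is a null set. *)
have before t' : s < t' -> t' <= s + y ->
    drift (t' - s) f y - ext f y = - tint (fun v => drift (v - s) (Dr f) y) s t'.
  move=> st' t'y.
  pose d v := - ext (deriv_Rp f) (y - (v - s)).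
  pose F v := ext f (y - (v - s)).
  have cg : continuous (fun v => y - (v - s)).
    move=> v; apply: cvgB; first exact: cvg_cst.
    by apply: cvgB; [exact: cvg_id|exact: cvg_cst].
  have cF : continuous F.
    by move=> v; apply: continuous_comp; [exact: cg|exact: ext_continuous].
  have cde : continuous d.
    move=> v; apply: cvgN; apply: continuous_comp; first exact: cg.
    exact: ext_continuous.
  have dF v : v \in `]s, t'[ -> is_derive v (1 : R) F (d v).
    rewrite in_itv/= => /andP[sv vt].
    have yv : 0 < y - (v - s) by lra.
    have Rv : Rp (y - (v - s)) by rewrite /Rp/= in_itv/= andbT ltW.
    have h1 := has_deriv_is_derive yv (df _ Rv).
    have h2 : is_derive v (1 : R) (fun v => y - (v - s)) (-1).
      apply/is_derive1_caratheodory; exists (fun _ => -1); split => //.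
        by move=> z; ring.
      exact: cst_continuous.
    rewrite /d ext_id ?(ltW yv)// -mulrN1.
    exact: (@is_derive1_comp R (ext f) (fun v => y - (v - s)) v _ _ h1 h2).
  have FTC := @continuous_FTC2 R d F s t' st' (continuous_subspaceT cde).
  have E : tint d s t' = F t' - F s.
    rewrite /tint /Rintegral FTC//.
      split.
      - by move=> v vst; have [] := dF v vst.
      - by apply: cvg_at_right_filter; exact: cF.
      - by apply: cvg_at_left_filter; exact: cF.
    by move=> v vst; rewrite derive1E; have [_ ->] := dF v vst.
  have -> : drift (t' - s) f y - ext f y = F t' - F s.
    by rewrite /F subrr subr0.
  rewrite -E.
  have bD : bmeas (fun v => drift (v - s) (Dr f) y).
    apply: (bmeas_comp (bmeas_Dr fC1)); apply: measurable_maxr => //.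
    by apply: measurable_funB => //; exact: measurable_funB.
  have bd : bmeas d.
    apply: bmeasN.
    have be : bmeas (ext (deriv_Rp f)).
      apply: bmeas_ext; split; last by have [] := fC1.
      by apply: subspace_continuous_measurable_fun => //; exact: measurable_Rp.
    apply: (bmeas_comp be); apply: measurable_funB => //; exact: measurable_funB.
  rewrite /tint.
  rewrite -(@Rintegral_itv_bndo_bndc _ (BLeft s) t' d); last first.
    apply: integrableS (bmeas_itv_integrable s t' bd) => //.
    by apply: subset_itvl; rewrite bnd_simp.
  rewrite -(@Rintegral_itv_bndo_bndc _ (BLeft s) t'
    (fun v => drift (v - s) (Dr f) y)); last first.
    apply: integrableS (bmeas_itv_integrable s t' bD) => //.
    by apply: subset_itvl; rewrite bnd_simp.
  rewrite -[in RHS]mulN1r -RintegralZl//; last first.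
    apply: integrableS (bmeas_itv_integrable s t' bD) => //.
    by apply: subset_itvl; rewrite bnd_simp.
  apply: eq_Rintegral => v; rewrite inE/= in_itv/= => /andP[sv vt].
  have yv : 0 < y - (v - s) by lra.
  by rewrite /d /drift (max0_id (ltW yv)) Dr_pos// ext_id ?(ltW yv)// mulN1r.
have [ty|yt] := leP t (s + y); first exact: before.
have bD : bmeas (fun v => drift (v - s) (Dr f) y).
  apply: (bmeas_comp (bmeas_Dr fC1)); apply: measurable_maxr => //.
  by apply: measurable_funB => //; exact: measurable_funB.
rewrite (@tint_cat _ _ s (s + y) t)//; last 3 first.
- by rewrite lerDl ltW.
- exact: ltW.
- exact: bmeas_itv_integrable.
rewrite [X in - (_ + X)](@eq_tint _ _ (fun _ => 0)) ?tint0; last first.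
  by move=> v /andP[sv _]; apply: stopped; lra.
rewrite addr0 -before ?ltrDl//; congr (_ - _).
by rewrite /drift !max_r//; lra.
Qed.

Lemma drift_lip f M c y : bounded_C1 f -> (forall x, `|Dr f x| <= M) -> 0 <= c ->
  `|drift c f y - ext f y| <= M * c.
Proof.
move=> fC1 fM c0; have := @drift_FTC f 0 c y fC1 c0.
rewrite !subr0 => ->; rewrite normrN -{2}[c]subr0.
apply: tint_bound => //; last by move=> v _; exact: fM.
apply: bmeas_itv_integrable.
apply: (bmeas_comp (bmeas_Dr fC1)); apply: measurable_maxr => //.
by apply: measurable_funB => //; exact: measurable_funB.
Qed.

Lemma bounded_C1_of_derive (u u' : R -> R) M :
  (forall x, is_derive x (1 : R) u (u' x)) -> continuous u' ->
  (forall x, `|u x| <= M) -> (forall x, `|u' x| <= M) ->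
  bounded_C1 u /\ (forall x, 0 <= x -> deriv_Rp u x = u' x).
Proof.
move=> du cu' uM u'M.
have dE x : 0 <= x -> deriv_Rp u x = u' x.
  by move=> x0; apply: has_deriv_eq => //; exact: is_derive_has_deriv.
split => //; split.
- split; last by apply/boundedP; exists M.
  apply: continuous_subspaceT => x; apply: differentiable_continuous.
  by apply/derivable1_diffP; have [] := du x.
- move=> x; rewrite /Rp/= in_itv/= andbT => x0; rewrite dE//.
  exact: is_derive_has_deriv.
- apply: (@subspace_eq_continuous _ _ _ u'); last exact: continuous_subspaceT.
  by move=> x; rewrite inE /Rp/= in_itv/= andbT => x0; exact/esym/dE.
- by apply/boundedP; exists M => x x0; rewrite dE.
Qed.

End drift_FTC.

(** * Smooth approximations of half-lines *)

Section test_functions.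
Context {R : realType}.
Implicit Types (a b x y z c : R).

Let sqr_normr x : `|x| ^+ 2 = x ^+ 2.
Proof. by rewrite real_normK// num_real. Qed.

(** A global second-order Taylor bound both gives the derivative and is the form in
    which test functions enter the second-order arguments on time. *)
Lemma is_derive_quadratic (u : R -> R) x l K :
  (forall y, `|u y - u x - l * (y - x)| <= K * (y - x) ^+ 2) ->
  is_derive x (1 : R) u l.
Proof.
move=> h; apply/is_deriveP => e e0.
have K0 : 0 <= K.
  have := h (x + 1); rewrite [x + 1 - x]addrAC subrr add0r expr1n !mulr1.
  exact: (le_trans (normr_ge0 _)).
exists (e / (K + 1)); first by rewrite divr_gt0// ltr_wpDl.
move=> y yx yxe; have d0 : y - x != 0 by rewrite subr_eq0.
have n0 : 0 < `|y - x| by rewrite normr_gt0.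
rewrite -(ltr_pM2r n0) -normrM /diff_quot mulrBl divfK//.
apply: (le_lt_trans (h y)); rewrite -sqr_normr expr2 mulrA ltr_pM2r//.
apply: (@le_lt_trans _ _ ((K + 1) * `|y - x|)); first by rewrite ler_wpM2r// lerDl.
by move: yxe; rewrite ltr_pdivlMr 1?mulrC// ltr_wpDl.
Qed.

Definition clip x : R := Num.max (Num.min x 1) 0.

Variant clip_spec x : R -> Type :=
| ClipLow of x <= 0 : clip_spec x 0
| ClipMid of 0 <= x & x <= 1 : clip_spec x x
| ClipHigh of 1 <= x : clip_spec x 1.

Lemma clipP x : clip_spec x (clip x).
Proof.
rewrite /clip; case: (leP x 1) => x1; case: leP => //; last 1 first.
- by move=> _; constructor; exact: ltW.
- by move=> x0; constructor.
- by move=> x0; constructor => //; exact: ltW.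
- by rewrite ler10.
Qed.

Lemma clip01 x : 0 <= clip x <= 1.
Proof. by case: clipP => *; apply/andP; split => //; rewrite ?ler01. Qed.

Lemma clip_lip x y : `|clip x - clip y| <= `|x - y|.
Proof.
have h1 := ler_norm (x - y); have h2 : y - x <= `|x - y| by rewrite distrC ler_norm.
by case: (clipP x); case: (clipP y) => *; rewrite ler_norml; apply/andP; split; lra.
Qed.

(** If the derivative vanishes at both ends of [0, 1], extending p by constants
    keeps it differentiable: the slope at a point of [0, 1] is at most K times the
    distance to the end that the segment crosses. *)
Lemma clip_taylor (p p' : R -> R) K :
  (forall a b, 0 <= a <= 1 -> 0 <= b <= 1 ->
     `|p b - p a - p' a * (b - a)| <= K * (b - a) ^+ 2) ->
  (forall a b, 0 <= a <= 1 -> 0 <= b <= 1 -> `|p' b - p' a| <= K * `|b - a|) ->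
  p' 0 = 0 -> p' 1 = 0 ->
  forall x y, `|p (clip y) - p (clip x) - p' (clip x) * (y - x)| <=
    2 * K * (y - x) ^+ 2.
Proof.
move=> tp lp p0 p1 x y.
have K0 : 0 <= K.
  have := lp 0 1; rewrite !lexx ler01 subr0 normr1 mulr1 => /(_ erefl erefl).
  exact: (le_trans (normr_ge0 _)).
rewrite (_ : _ - _ = (p (clip y) - p (clip x) - p' (clip x) * (clip y - clip x)) +
  p' (clip x) * ((clip y - clip x) - (y - x))); last by ring.
apply: (le_trans (ler_normD _ _)).
have -> : 2 * K * (y - x) ^+ 2 = K * (y - x) ^+ 2 + K * (y - x) ^+ 2 by ring.
apply: lerD.
  apply: (le_trans (tp _ _ (clip01 _) (clip01 _))); rewrite ler_wpM2l//.
  by rewrite -[leLHS]sqr_normr -[leRHS]sqr_normr lerXn2r ?nnegrE// clip_lip.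
have [->|[e [e01 pe h1 h2]]] : p' (clip x) * ((clip y - clip x) - (y - x)) = 0 \/
    exists e, [/\ 0 <= e <= 1, p' e = 0, `|clip x - e| <= `|y - x| &
      `|(clip y - clip x) - (y - x)| <= `|y - x|].
- case: (clipP x) => [_|x0 x1|_]; [by left; rewrite p0 mul0r| |by left; rewrite p1 mul0r].
  case: (clipP y) => [y0|y0 y1|y1]; [right|by left; rewrite subrr mulr0|right].
  + exists 0; split => //; first by rewrite lexx ler01.
      by rewrite ger0_norm ?ler0_norm; lra.
    by rewrite ger0_norm ?ler0_norm; lra.
  + exists 1; split => //; first by rewrite lexx ler01.
      by rewrite ler0_norm ?ger0_norm; lra.
    by rewrite ler0_norm ?ger0_norm; lra.
- by rewrite normr0 mulr_ge0// sqr_ge0.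
rewrite normrM -[in leRHS]sqr_normr expr2 mulrA; apply: ler_pM => //.
rewrite -[p' (clip x)]subr0 -pe; apply: (le_trans (lp _ _ e01 (clip01 _))).
by rewrite ler_wpM2l.
Qed.

(** A C2 function rising from 0 to 1 on [0, 1]: the polynomial 10c^3 - 15c^4 + 6c^5
    of the clipped argument, whose first and second derivatives [step1] and [step2]
    vanish at both ends of [0, 1]. *)
Definition step0 x := let c := clip x in c ^+ 3 * (10 - 15 * c + 6 * c ^+ 2).
Definition step1 x := let c := clip x in 30 * c ^+ 2 * (1 - c) ^+ 2.
Definition step2 x := let c := clip x in 60 * c * (1 - c) * (1 - 2 * c).

(** The constants 1000 and 2000 are rough bounds on the sums of the absolute values
   of the coefficients of the remainders. *)
Lemma step0_taylor x y :
  `|step0 y - step0 x - step1 x * (y - x)| <= 2000 * (y - x) ^+ 2.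
Proof.
rewrite (_ : 2000 = 2 * 1000); last by rewrite -natrM.
apply: (@clip_taylor (fun c => c ^+ 3 * (10 - 15 * c + 6 * c ^+ 2))
  (fun c => 30 * c ^+ 2 * (1 - c) ^+ 2)).
- move=> a b /andP[a0 a1] /andP[b0 b1].
  rewrite (_ : _ - _ = (b - a) ^+ 2 * (10 * (b + 2 * a) -
    15 * (b ^+ 2 + 2 * a * b + 3 * a ^+ 2) +
    6 * (b ^+ 3 + 2 * a * b ^+ 2 + 3 * a ^+ 2 * b + 4 * a ^+ 3))); last by ring.
  rewrite normrM ger0_norm ?sqr_ge0// mulrC ler_wpM2r ?sqr_ge0//.
  have a2 : 0 <= a ^+ 2 <= 1 by rewrite exprn_ge0// exprn_ile1.
  have a3 : 0 <= a ^+ 3 <= 1 by rewrite exprn_ge0// exprn_ile1.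
  have b2 : 0 <= b ^+ 2 <= 1 by rewrite exprn_ge0// exprn_ile1.
  have b3 : 0 <= b ^+ 3 <= 1 by rewrite exprn_ge0// exprn_ile1.
  have ab : 0 <= a * b <= 1 by rewrite mulr_ge0// mulr_ile1.
  have ab2 : 0 <= a * b ^+ 2 <= 1 by case/andP: b2 => *; rewrite mulr_ge0// mulr_ile1.
  have a2b : 0 <= a ^+ 2 * b <= 1 by case/andP: a2 => *; rewrite mulr_ge0// mulr_ile1.
  by rewrite ler_norml; apply/andP; split; lra.
- move=> a b /andP[a0 a1] /andP[b0 b1].
  rewrite (_ : _ - _ = (b - a) * (30 * (b + a) - 60 * (b ^+ 2 + a * b + a ^+ 2) +
    30 * (b ^+ 3 + a * b ^+ 2 + a ^+ 2 * b + a ^+ 3))); last by ring.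
  rewrite normrM mulrC ler_wpM2r//.
  have a2 : 0 <= a ^+ 2 <= 1 by rewrite exprn_ge0// exprn_ile1.
  have a3 : 0 <= a ^+ 3 <= 1 by rewrite exprn_ge0// exprn_ile1.
  have b2 : 0 <= b ^+ 2 <= 1 by rewrite exprn_ge0// exprn_ile1.
  have b3 : 0 <= b ^+ 3 <= 1 by rewrite exprn_ge0// exprn_ile1.
  have ab : 0 <= a * b <= 1 by rewrite mulr_ge0// mulr_ile1.
  have ab2 : 0 <= a * b ^+ 2 <= 1 by case/andP: b2 => *; rewrite mulr_ge0// mulr_ile1.
  have a2b : 0 <= a ^+ 2 * b <= 1 by case/andP: a2 => *; rewrite mulr_ge0// mulr_ile1.
  by rewrite ler_norml; apply/andP; split; lra.
- by ring.
- by ring.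
Qed.

Lemma step1_taylor x y :
  `|step1 y - step1 x - step2 x * (y - x)| <= 2000 * (y - x) ^+ 2.
Proof.
rewrite (_ : 2000 = 2 * 1000); last by rewrite -natrM.
apply: (@clip_taylor (fun c => 30 * c ^+ 2 * (1 - c) ^+ 2)
  (fun c => 60 * c * (1 - c) * (1 - 2 * c))).
- move=> a b /andP[a0 a1] /andP[b0 b1].
  rewrite (_ : _ - _ = (b - a) ^+ 2 * (30 - 60 * (b + 2 * a) +
    30 * (b ^+ 2 + 2 * (a * b) + 3 * a ^+ 2))); last by ring.
  rewrite normrM ger0_norm ?sqr_ge0// mulrC ler_wpM2r ?sqr_ge0//.
  have a2 : 0 <= a ^+ 2 <= 1 by rewrite exprn_ge0// exprn_ile1.
  have b2 : 0 <= b ^+ 2 <= 1 by rewrite exprn_ge0// exprn_ile1.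
  have ab : 0 <= a * b <= 1 by rewrite mulr_ge0// mulr_ile1.
  by rewrite ler_norml; apply/andP; split; lra.
- move=> a b /andP[a0 a1] /andP[b0 b1].
  rewrite (_ : _ - _ = (b - a) * (60 - 180 * (b + a) +
    120 * (b ^+ 2 + a * b + a ^+ 2))); last by ring.
  rewrite normrM mulrC ler_wpM2r//.
  have a2 : 0 <= a ^+ 2 <= 1 by rewrite exprn_ge0// exprn_ile1.
  have b2 : 0 <= b ^+ 2 <= 1 by rewrite exprn_ge0// exprn_ile1.
  have ab : 0 <= a * b <= 1 by rewrite mulr_ge0// mulr_ile1.
  by rewrite ler_norml; apply/andP; split; lra.
- by ring.
- by ring.
Qed.


Lemma is_derive_continuous (u u' : R -> R) :
  (forall x, is_derive x (1 : R) u (u' x)) -> continuous u.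
Proof.
move=> du x; apply: differentiable_continuous.
by apply/derivable1_diffP; have [] := du x.
Qed.

Lemma is_derive_step0 x : is_derive x (1 : R) step0 (step1 x).
Proof. exact: is_derive_quadratic (step0_taylor x). Qed.

Lemma is_derive_step1 x : is_derive x (1 : R) step1 (step2 x).
Proof. exact: is_derive_quadratic (step1_taylor x). Qed.

Lemma clip_continuous : continuous clip.
Proof.
move=> x; apply: (@continuous_max _ _ (fun x => Num.min x 1) (fun _ => 0)).
  by apply: (@continuous_min _ _ id (fun _ => 1)); [exact: cvg_id|exact: cst_continuous].
exact: cst_continuous.
Qed.

Lemma step2_continuous : continuous step2.
Proof.
have c1 : continuous (fun x => 60 * clip x).
  by move=> x; apply: cvgM; [exact: cvg_cst|exact: clip_continuous].
have c2 : continuous (fun x => 1 - clip x).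
  by move=> x; apply: cvgB; [exact: cvg_cst|exact: clip_continuous].
have c3 : continuous (fun x => 1 - 2 * clip x).
  move=> x; apply: cvgB; first exact: cvg_cst.
  by apply: cvgM; [exact: cvg_cst|exact: clip_continuous].
move=> x; apply: cvgM; last exact: c3.
by apply: cvgM; [exact: c1|exact: c2].
Qed.

Lemma step0_bound x : `|step0 x| <= 1.
Proof.
rewrite /step0; have /andP[c0 c1] := clip01 x.
set c := clip x in c0 c1 *; rewrite /=.
have h1 : 0 <= c ^+ 3 * (10 - 15 * c + 6 * c ^+ 2).
  by rewrite mulr_ge0 ?exprn_ge0//; nra.
have h2 : 1 - c ^+ 3 * (10 - 15 * c + 6 * c ^+ 2) =
    (1 - c) ^+ 3 * (1 + 3 * c + 6 * c ^+ 2) by ring.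
have h3 : 0 <= (1 - c) ^+ 3 * (1 + 3 * c + 6 * c ^+ 2).
  rewrite mulr_ge0 ?exprn_ge0//; first lra.
  by have := sqr_ge0 c; lra.
by rewrite ger0_norm//; lra.
Qed.

Lemma step1_bound x : `|step1 x| <= 30.
Proof.
rewrite /step1; have /andP[c0 c1] := clip01 x; set c := clip x in c0 c1 *.
have d0 : 0 <= 1 - c by lra.
rewrite /= ger0_norm; last by rewrite !mulr_ge0// exprn_ge0.
rewrite -mulrA ler_piMr//; apply: mulr_ile1; rewrite ?exprn_ge0// exprn_ile1//.
by lra.
Qed.

Lemma step2_bound x : `|step2 x| <= 60.
Proof.
rewrite /step2; have /andP[c0 c1] := clip01 x; set c := clip x in c0 c1 *.
have d0 : 0 <= 1 - c by lra.
rewrite /= normrM -[leRHS]mulr1; apply: ler_pM => //; last first.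
  by rewrite ler_norml; apply/andP; split; lra.
rewrite ger0_norm; last by rewrite !mulr_ge0.
by rewrite -mulrA ler_piMr// mulr_ile1//; lra.
Qed.

Lemma clip_le0 x : x <= 0 -> clip x = 0.
Proof. by case: clipP => //; lra. Qed.

Lemma clip_ge1 x : 1 <= x -> clip x = 1.
Proof. by case: clipP => //; lra. Qed.

Lemma step0_le0 x : x <= 0 -> step0 x = 0.
Proof. by move=> x0; rewrite /step0 clip_le0//; ring. Qed.

Lemma step0_ge1 x : 1 <= x -> step0 x = 1.
Proof. by move=> x0; rewrite /step0 clip_ge1//; ring. Qed.

Lemma step1_le0 x : x <= 0 -> step1 x = 0.
Proof. by move=> x0; rewrite /step1 clip_le0//; ring. Qed.

(** Smooth approximations of the indicator of the half-line above [c]. *)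
Definition psi (n : nat) c : R -> R := fun x => step0 (n%:R * (x - c)).
Definition dpsi (n : nat) c : R -> R := fun x => n%:R * step1 (n%:R * (x - c)).

Lemma psi_taylor : exists2 K : R, 0 <= K & forall n b c x,
  `|psi n b x - psi n c x - dpsi n c x * (c - b)| <= K * n%:R ^+ 2 * (c - b) ^+ 2.
Proof.
exists 2000; first exact: ler0n.
move=> n b c x; have := step0_taylor (n%:R * (x - c)) (n%:R * (x - b)).
have -> : n%:R * (x - b) - n%:R * (x - c) = n%:R * (c - b) by ring.
rewrite /psi /dpsi.
have -> : 2000 * (n%:R * (c - b)) ^+ 2 = 2000 * n%:R ^+ 2 * (c - b) ^+ 2 by ring.
by have -> : step1 (n%:R * (x - c)) * (n%:R * (c - b)) =
  n%:R * step1 (n%:R * (x - c)) * (c - b) by ring.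
Qed.

Lemma psi_bound n c x : `|psi n c x| <= 1.
Proof. exact: step0_bound. Qed.

Lemma dpsi_bound n c x : `|dpsi n c x| <= n%:R * 30.
Proof. by rewrite /dpsi normrM normr_nat ler_wpM2l// step1_bound. Qed.

Lemma psi_C1 n c : bounded_C1 (psi n c) /\
  (forall x, 0 <= x -> deriv_Rp (psi n c) x = dpsi n c x).
Proof.
apply: (@bounded_C1_of_derive _ _ _ (1 + n%:R * 30)).
- move=> x; apply: (@is_derive_quadratic _ _ _ (2000 * n%:R ^+ 2)) => y.
  have := step0_taylor (n%:R * (x - c)) (n%:R * (y - c)).
  have -> : n%:R * (y - c) - n%:R * (x - c) = n%:R * (y - x) by ring.
  rewrite /psi /dpsi.
  have -> : 2000 * (n%:R * (y - x)) ^+ 2 = 2000 * n%:R ^+ 2 * (y - x) ^+ 2 by ring.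
  by have -> : step1 (n%:R * (x - c)) * (n%:R * (y - x)) =
    n%:R * step1 (n%:R * (x - c)) * (y - x) by ring.
- move=> x; apply: cvgM; first exact: cvg_cst.
  apply: (@continuous_comp _ _ _ (fun x => n%:R * (x - c)) step1).
    apply: cvgM; first exact: cvg_cst.
    by apply: cvgB; [exact: cvg_id|exact: cvg_cst].
  exact: is_derive_continuous is_derive_step1 _.
- by move=> x; rewrite (le_trans (psi_bound _ _ _))// lerDl mulr_ge0.
- by move=> x; rewrite (le_trans (dpsi_bound _ _ _))// lerDr.
Qed.

Lemma dpsi_C1 n c : bounded_C1 (dpsi n c) /\
  (forall x, `|Dr (dpsi n c) x| <= n%:R ^+ 2 * 60).
Proof.
pose d x := n%:R ^+ 2 * step2 (n%:R * (x - c)).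
have d60 x : `|d x| <= n%:R ^+ 2 * 60.
  by rewrite /d normrM ger0_norm ?exprn_ge0// ler_wpM2l ?exprn_ge0// step2_bound.
suff [bC dE] : bounded_C1 (dpsi n c) /\ (forall x, 0 <= x -> deriv_Rp (dpsi n c) x = d x).
  split => // x; have [x0|x0] := leP x 0; last by rewrite Dr_pos// dE ?d60 ?ltW.
  by rewrite Dr_le0// normr0 mulr_ge0// exprn_ge0.
apply: (@bounded_C1_of_derive _ _ _ (n%:R ^+ 2 * 60 + n%:R * 30)).
- move=> x; apply: (@is_derive_quadratic _ _ _ (n%:R * (2000 * n%:R ^+ 2))) => y.
  have := step1_taylor (n%:R * (x - c)) (n%:R * (y - c)).
  have -> : n%:R * (y - c) - n%:R * (x - c) = n%:R * (y - x) by ring.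
  rewrite exprMn => h.
  have -> : dpsi n c y - dpsi n c x - d x * (y - x) = n%:R *
    (step1 (n%:R * (y - c)) - step1 (n%:R * (x - c)) -
       step2 (n%:R * (x - c)) * (n%:R * (y - x))) by rewrite /dpsi /d; ring.
  rewrite normrM normr_nat -[leRHS]mulrA ler_wpM2l//; apply: (le_trans h).
  by rewrite mulrA.
- move=> x; apply: cvgM; first exact: cvg_cst.
  apply: (@continuous_comp _ _ _ (fun x => n%:R * (x - c)) step2).
    apply: cvgM; first exact: cvg_cst.
    by apply: cvgB; [exact: cvg_id|exact: cvg_cst].
  exact: step2_continuous.
- by move=> x; rewrite (le_trans (dpsi_bound _ _ _))// lerDr mulr_ge0// exprn_ge0.
- by move=> x; rewrite (le_trans (d60 _))// lerDl mulr_ge0.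
Qed.

Lemma dpsi_le n c x : x <= c -> dpsi n c x = 0.
Proof.
by move=> xc; rewrite /dpsi step1_le0 ?mulr0// mulr_ge0_le0// subr_le0.
Qed.

Lemma Dr_psi n c : 0 <= c -> Dr (psi n c) = dpsi n c.
Proof.
move=> c0; apply/funext => x; have [x0|x0] := leP x 0.
  by rewrite Dr_le0// dpsi_le// (le_trans x0).
by rewrite Dr_pos// (psi_C1 n c).2// ltW.
Qed.

Lemma psi_C1_star n c : 0 <= c -> bounded_C1_star (psi n c).
Proof.
by move=> c0; split; [exact: (psi_C1 n c).1|rewrite (psi_C1 n c).2// dpsi_le].
Qed.

Lemma psi_lip n b c x : `|psi n b x - psi n c x| <= n%:R * 30 * `|b - c|.
Proof.
have lip u v : u <= v -> `|step0 v - step0 u| <= 30 * (v - u).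
  move=> uv; have [//|w _ ->] := @MVT_segment R step0 step1 u v uv
    (fun x _ => is_derive_step0 x).
    by apply: continuous_subspaceT; exact: is_derive_continuous is_derive_step0.
  by rewrite normrM [`|v - u|]ger0_norm ?subr_ge0// ler_wpM2r ?subr_ge0// step1_bound.
wlog bc : b c / b <= c.
  move=> h; have [/h//|/ltW/h] := leP b c.
  by rewrite distrC [`|b - c|]distrC.
have := lip (n%:R * (x - c)) (n%:R * (x - b)).
rewrite ler_wpM2l ?lerD2l ?lerN2// => /(_ erefl) /le_trans; apply.
rewrite ler0_norm ?subr_le0// le_eqVlt; apply/orP; left; apply/eqP; ring.
Qed.

Lemma psi_cvg c x : psi n c x @[n --> \oo] --> (\1_(tail c) x : R).
Proof.
rewrite indicE; have [cx|xc] := boolP (x \in tail c).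
  move: cx; rewrite inE /tail/= in_itv/= andbT => cx.
  apply: cvg_near_cst; near=> n.
  rewrite /psi step0_ge1// -ler_pdivrMr ?subr_gt0// mul1r.
  by near: n; exact: nbhs_infty_ger.
move: xc; rewrite notin_setE /tail/= in_itv/= andbT => /negP; rewrite -leNgt => xc.
rewrite (_ : (fun n => _) = fun _ => 0); first exact: cvg_cst.
by apply/funext => n; rewrite /psi step0_le0// mulr_ge0_le0// subr_le0.
Unshelve. all: by end_near. Qed.

Lemma measurable_psi n d (T : measurableType d) (c x : T -> R) :
  measurable_fun setT c -> measurable_fun setT x ->
  measurable_fun setT (fun t => psi n (c t) (x t)).
Proof.
move=> mc mx; apply: (@measurableT_comp _ _ _ _ _ _ step0).
  by apply: continuous_measurable_fun; exact: is_derive_continuous is_derive_step0.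
by apply: measurable_funM => //; exact: measurable_funB.
Qed.

Lemma bmeas_psi n d (T : measurableType d) (c x : T -> R) :
  measurable_fun setT c -> measurable_fun setT x ->
  bmeas (fun t => psi n (c t) (x t)).
Proof.
by move=> mc mx; split; [exact: measurable_psi|exists 1 => t; exact: psi_bound].
Qed.

End test_functions.

(** * Flows of measures solving the integrated forward equation *)

Lemma Rint_prob_cst (R : realType) (p : probability R R) (c : R) :
  \int[p]_x c = c.
Proof.
by rewrite Rintegral_cst// [X in fine X](_ : _ = 1%E) ?mulr1//; exact: probability_setT.
Qed.

(** The bookkeeping of [integrated_transport], with integrals as atoms. *)
Lemma transport_algebra (R : realType) (A B C T1 T2 q d D e : R) :
  A - B = q - d ->
  A - (T1 + T2) - (C - T1) = (q - T2) + (D * e - d) - (C - B - D * - e).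
Proof. by move=> /eqP; rewrite subr_eq => /eqP ->; ring. Qed.

Section dynamics.
Context {R : realType}.
Variables (a : R) (m : R -> probability R R).
Hypotheses (a_ge0 : 0 <= a) (km : subker m).
Implicit Types (f h : R -> R) (r s t v x y : R).

Let moo s : (m s setT < +oo)%E. Proof. by apply: le1_lty; exact: km.2. Qed.

(** The effect on h of one jump, with law [m s]. *)
Definition jump s h : R -> R := fun y => \int[m s]_z h (y + z).

(** The generator, extended to the whole line. *)
Definition gen s f : R -> R := fun y => a * (jump s (ext f) y - ext f y) - Dr f y.

Lemma bmeas_jump2 (F : R * R -> R) : bmeas F ->
  bmeas (fun p : R * R => jump p.1 (fun y => F (p.1, y)) p.2).
Proof.
move=> bF; have km' : subker (fun p : R * R => m p.1).
  split => [V mV|p]; last exact: km.2.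
  by apply: measurableT_comp (km.1 _ mV) _; exact: measurable_fst.
have := @subker_bmeas _ _ _ _ _ _ (fun q : (R * R) * R => F (q.1.1, q.1.2 + q.2)) km'.
apply; apply: (bmeas_comp bF); apply: measurable_fun_pair => /=.
  exact: measurableT_comp measurable_fst measurable_fst.
apply: measurable_funD; last exact: measurable_snd.
exact: measurableT_comp measurable_snd measurable_fst.
Qed.

Lemma bmeas_snd h : bmeas h -> bmeas (fun p : R * R => h p.2).
Proof. by move=> bh; apply: (bmeas_comp bh); exact: measurable_snd. Qed.

Lemma bmeas_pair (F : R * R -> R) v : bmeas F -> bmeas (fun y => F (v, y)).
Proof. by move=> bF; apply: (bmeas_comp bF); exact: pair1_measurable. Qed.

Lemma bmeas_jump s h : bmeas h -> bmeas (jump s h).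
Proof. by move=> /bmeas_snd/bmeas_jump2/(bmeas_pair s). Qed.

Lemma jump_bound s h M y : bmeas h -> (forall x, `|h x| <= M) -> `|jump s h y| <= M.
Proof.
move=> bh hM; apply: Rint_bound => //; first exact: km.2.
- by apply: (bmeas_comp bh); exact: measurable_funD.
- exact: (le_trans (normr_ge0 _) (hM 0)).
Qed.

Lemma jumpB s h1 h2 y : bmeas h1 -> bmeas h2 ->
  jump s (fun x => h1 x - h2 x) y = jump s h1 y - jump s h2 y.
Proof.
move=> b1 b2; apply: RintB; first exact: moo.
  by apply: (bmeas_comp b1); exact: measurable_funD.
by apply: (bmeas_comp b2); exact: measurable_funD.
Qed.

Lemma bounded_C1_bmeas f : bounded_C1 f -> bmeas (ext f).
Proof. by move=> fC; apply: bmeas_ext; exact: bounded_C1_borel. Qed.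

Lemma bmeas_gen2 f : bounded_C1 f -> bmeas (fun p : R * R => gen p.1 f p.2).
Proof.
move=> fC; have be := bounded_C1_bmeas fC; apply: bmeasB.
  apply: bmeasZ; apply: bmeasB; last exact: bmeas_snd.
  exact: (bmeas_jump2 (bmeas_snd be)).
by apply: bmeas_snd; exact: bmeas_Dr.
Qed.

Lemma bmeas_gen s f : bounded_C1 f -> bmeas (gen s f).
Proof. by move=> /bmeas_gen2/(bmeas_pair s). Qed.

Lemma gen_bound s f M N y : bounded_C1 f -> (forall x, `|ext f x| <= M) ->
  (forall x, `|Dr f x| <= N) -> `|gen s f y| <= a * (M + M) + N.
Proof.
move=> fC fM fN; apply: (le_trans (ler_normB _ _)); apply: lerD; last exact: fN.
rewrite normrM ger0_norm// ler_wpM2l//; apply: (le_trans (ler_normB _ _)).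
by apply: lerD; [exact: jump_bound (bounded_C1_bmeas fC) _|exact: fM].
Qed.

Section flow.
Variable nu : R -> {measure set R -> \bar R}.

(** The forward equation, integrated in time because [s |-> <nu_s, A_s f>] is in
    general only measurable. *)
Definition integrated r : Prop := forall f t, bounded_C1 f -> r <= t ->
  \int[nu t]_x ext f x = \int[nu r]_x ext f x +
    tint (fun v => \int[nu v]_x gen v f x) r t.

Hypothesis knu : subker nu.

Let nuoo s : (nu s setT < +oo)%E. Proof. exact: le1_lty (knu.2 s). Qed.

Lemma bmeas_flow (F : R * R -> R) : bmeas F -> bmeas (fun v => \int[nu v]_y F (v, y)).
Proof. exact: subker_bmeas. Qed.

Lemma bmeas_flow_gen f : bounded_C1 f -> bmeas (fun v => \int[nu v]_y gen v f y).
Proof. by move=> /bmeas_gen2/bmeas_flow. Qed.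

Lemma integrated_between r f s t : integrated r -> bounded_C1 f ->
  r <= s -> s <= t ->
  \int[nu t]_x ext f x - \int[nu s]_x ext f x =
    tint (fun v => \int[nu v]_x gen v f x) s t.
Proof.
move=> I fC rs st; rewrite (I _ _ fC rs) (I _ _ fC (le_trans rs st)).
rewrite (@tint_cat _ _ r s t)//; last by apply: bmeas_itv_integrable; exact: bmeas_flow_gen.
by ring.
Qed.

Lemma integrated_lip r f s t M N : integrated r -> bounded_C1 f ->
  (forall x, `|ext f x| <= M) -> (forall x, `|Dr f x| <= N) ->
  r <= s -> s <= t ->
  `|\int[nu t]_x ext f x - \int[nu s]_x ext f x| <= (a * (M + M) + N) * (t - s).
Proof.
move=> I fC fM fN rs st; rewrite (integrated_between I)//.
have MN0 : 0 <= a * (M + M) + N.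
  have M0 := le_trans (normr_ge0 _) (fM 0); have N0 := le_trans (normr_ge0 _) (fN 0).
  by rewrite addr_ge0// mulr_ge0// addr_ge0.
apply: tint_bound => //; first by apply: bmeas_itv_integrable; exact: bmeas_flow_gen.
move=> v _; apply: Rint_bound => //; [exact: knu.2|exact: bmeas_gen|].
by move=> x; exact: gen_bound.
Qed.

(** The constant 1 is a test function killed by the generator. *)
Lemma integrated_mass r t : integrated r -> r <= t ->
  \int[nu t]_x 1 = \int[nu r]_x 1.
Proof.
move=> I rt.
have [C1 d1] : bounded_C1 (fun _ : R => 1 : R) /\
    (forall x : R, 0 <= x -> deriv_Rp (fun _ => 1) x = (fun _ => 0) x).
  apply: (@bounded_C1_of_derive _ (fun _ => 1) (fun _ => 0) 1).
  - exact: cst_continuous.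
  - by move=> x; rewrite normr1.
  - by move=> x; rewrite normr0.
have := I _ _ C1 rt; rewrite {1 2}/ext => ->.
rewrite (@eq_tint _ _ (fun _ => 0)) ?tint0 ?addr0// => v _.
rewrite (@eq_Rintegral _ _ _ _ _ (fun _ => 0)) ?Rintegral_cst ?mul0r// => x _.
rewrite /gen; have -> : Dr (fun _ => 1) x = 0 :> R.
  by have [x0|x0] := leP x 0; [rewrite Dr_le0|rewrite Dr_pos// d1// ltW].
by rewrite /jump /ext Rint_prob_cst subrr mulr0 subr0.
Qed.

Lemma ext_psi n (c : R) : 0 <= c -> ext (psi n c) = psi n c.
Proof.
move=> c0; apply/funext => x; have [x0|x0] := leP 0 x; first by rewrite ext_id.
rewrite /ext max_r ?(ltW x0)// /psi !step0_le0//.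
  by rewrite mulr_ge0_le0// subr_le0 (le_trans (ltW x0)).
by rewrite mulr_ge0_le0// subr_le0.
Qed.

Lemma ext_dpsi n (c : R) : 0 <= c -> ext (dpsi n c) = dpsi n c.
Proof.
move=> c0; apply/funext => x; have [x0|x0] := leP 0 x; first by rewrite ext_id.
by rewrite /ext max_r ?(ltW x0)// !dpsi_le// (le_trans (ltW x0)).
Qed.

(** The rate of change of [v |-> <nu_v, psi_(b + t - v)>] due to jumps. *)
Definition transport n (b t v : R) : R := \int[nu v]_x
  (a * (jump v (psi n (b + t - v)) x - psi n (b + t - v) x)).

Lemma bmeas_transport n (b t : R) : bmeas (transport n b t).
Proof.
have bF : bmeas (fun p : R * R => psi n (b + t - p.1) p.2).
  by apply: bmeas_psi; [exact: measurable_funB|exact: measurable_snd].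
apply: (@bmeas_flow (fun p => a * (jump p.1 (psi n (b + t - p.1)) p.2 -
  psi n (b + t - p.1) p.2))).
by apply: bmeasZ; apply: bmeasB => //; exact: bmeas_jump2 bF.
Qed.

Let bpsi n (c : R) : bmeas (psi n c).
Proof. by apply: bmeas_psi => //; exact: measurable_cst. Qed.

Let bdpsi n (c : R) : 0 <= c -> bmeas (dpsi n c).
Proof. by move=> c0; rewrite -ext_dpsi//; apply: bounded_C1_bmeas; exact: (dpsi_C1 n c).1. Qed.

(** Along [s |-> <nu_s, psi(. - (b + t - s))>] the drift part of the generator
    compensates the motion of the test function, so that only the jumps contribute.
    The error over a short interval is of second order because [psi] and [dpsi] are
    themselves test functions, so that their integrals are Lipschitz in time. *)
Lemma integrated_transport r n (b t : R) : integrated r -> r <= t -> 0 <= b ->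
  \int[nu t]_x psi n b x = \int[nu r]_x psi n (b + t - r) x +
    tint (transport n b t) r t.
Proof.
move=> I rt b0.
pose c v := b + t - v.
pose H s := \int[nu s]_x psi n (c s) x - tint (transport n b t) r s.
have bT := bmeas_transport n b t.
have [L L0 taylorL] := @psi_taylor R.
pose K : R := a * (2 * (n%:R * 30)) + (a * (n%:R * 30 + n%:R * 30) + n%:R ^+ 2 * 60) +
  L * n%:R ^+ 2.
have n30 : 0 <= n%:R * 30 :> R by rewrite mulr_ge0.
suff : H t = H r.
  rewrite /H tint_point subr0 /c addrK => /eqP; rewrite subr_eq => /eqP ->//.
apply: (@quadratic_const _ H K r t rt) => s s' rs ss' s't.
have st : s <= t := le_trans ss' s't.
have c'0 : 0 <= c s' by rewrite /c; lra.
have c0 : 0 <= c s by rewrite /c; lra.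
have [pC _] := psi_C1 n (c s').
have [dC dN] := dpsi_C1 n (c s').
pose Q v := \int[nu v]_x (a * (jump v (psi n (c s')) x - psi n (c s') x)).
pose D v := \int[nu v]_x dpsi n (c s') x.
have bjp v : bmeas (fun x => a * (jump v (psi n (c s')) x - psi n (c s') x)).
  by apply: bmeasZ; apply: bmeasB => //; exact: bmeas_jump.
have bQ : bmeas Q.
  apply: (@bmeas_flow (fun p => a * (jump p.1 (psi n (c s')) p.2 - psi n (c s') p.2))).
  apply: bmeasZ; apply: bmeasB; last exact: bmeas_snd.
  exact: (bmeas_jump2 (bmeas_snd (bpsi n (c s')))).
have bD : bmeas D.
  by apply: (@bmeas_flow (fun p => dpsi n (c s') p.2)); apply: bmeas_snd; exact: bdpsi.
have E1 : \int[nu s']_x psi n (c s') x - \int[nu s]_x psi n (c s') x =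
    tint Q s s' - tint D s s'.
  rewrite -[in LHS](ext_psi n c'0) (integrated_between I)//.
  rewrite -tintB; try exact: bmeas_itv_integrable.
  apply: eq_tint => v _; rewrite /Q /D -RintB//; last exact: bdpsi.
  by apply: eq_Rintegral => x _; rewrite /gen Dr_psi// ext_psi.
have E2 : `|tint Q s s' - tint (transport n b t) s s'| <=
    (a * (2 * (n%:R * 30))) * (s' - s) * (s' - s).
  apply: tint_close => //; try exact: bmeas_itv_integrable.
  move=> v /andP[sv vs'].
  have bjv : bmeas (fun x => a * (jump v (psi n (c v)) x - psi n (c v) x)).
    by apply: bmeasZ; apply: bmeasB => //; exact: bmeas_jump.
  rewrite /Q /transport -/(c v) -RintB//.
  have lip x : `|psi n (c s') x - psi n (c v) x| <= n%:R * 30 * (s' - s).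
    apply: (le_trans (psi_lip _ _ _ _)); rewrite ler_wpM2l//.
    have -> : c s' - c v = v - s' by rewrite /c; ring.
    by rewrite distrC ger0_norm ?subr_ge0// lerB.
  apply: Rint_bound; [exact: knu.2|exact: bmeasB| |].
    by rewrite mulr_ge0 ?subr_ge0// mulr_ge0// mulr_ge0.
  move=> x.
  rewrite (_ : _ - _ = a * ((jump v (psi n (c s')) x - jump v (psi n (c v)) x) -
    (psi n (c s') x - psi n (c v) x))); last by ring.
  rewrite normrM (ger0_norm a_ge0) -mulrA ler_wpM2l//.
  rewrite (_ : 2 * (n%:R * 30) * (s' - s) =
    n%:R * 30 * (s' - s) + n%:R * 30 * (s' - s)); last by ring.
  apply: (le_trans (ler_normB _ _)); apply: lerD => //.
  by rewrite -jumpB//; apply: jump_bound => //; exact: bmeasB.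
have E3 : `|tint (fun _ => D s) s s' - tint D s s'| <=
    (a * (n%:R * 30 + n%:R * 30) + n%:R ^+ 2 * 60) * (s' - s) * (s' - s).
  apply: tint_close => //.
  - by apply: bmeas_itv_integrable; exact: bmeas_cst.
  - exact: bmeas_itv_integrable.
  move=> v /andP[sv vs']; rewrite distrC /D.
  have := @integrated_lip r (dpsi n (c s')) s v (n%:R * 30) (n%:R ^+ 2 * 60) I dC.
  rewrite ext_dpsi// => h; apply: (le_trans (h _ _ _ _)) => //.
  - by move=> x; exact: dpsi_bound.
  - rewrite ler_wpM2l ?lerB//.
    by rewrite addr_ge0 ?mulr_ge0 ?exprn_ge0 ?addr_ge0.
have E4 : `|\int[nu s]_x psi n (c s) x - \int[nu s]_x psi n (c s') x -
     D s * (c s' - c s)| <= L * n%:R ^+ 2 * (s' - s) ^+ 2.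
  rewrite -RintB// /D mulrC -RintZ//; last exact: bdpsi.
  rewrite -RintB//; last 2 first.
  - exact: bmeasB.
  - by apply: bmeasZ; exact: bdpsi.
  apply: Rint_bound; first exact: knu.2.
  - by apply: bmeasB; [exact: bmeasB|apply: bmeasZ; exact: bdpsi].
  - by apply: mulr_ge0; [apply: mulr_ge0 => //; exact: exprn_ge0|exact: sqr_ge0].
  move=> x; rewrite mulrC; have := taylorL n (c s) (c s') x.
  by rewrite [X in _ <= X -> _](_ : _ = L * n%:R ^+ 2 * (s' - s) ^+ 2)//; rewrite /c; ring.
rewrite tint_cst// in E3.
have E5 : tint (transport n b t) r s' =
    tint (transport n b t) r s + tint (transport n b t) s s'.
  by apply: tint_cat => //; exact: bmeas_itv_integrable.
rewrite /H E5.
rewrite (_ : _ - _ = (tint Q s s' - tint (transport n b t) s s') +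
  (D s * (s' - s) - tint D s s') - (\int[nu s]_x psi n (c s) x -
  \int[nu s]_x psi n (c s') x - D s * (c s' - c s))); last first.
  have -> : c s' - c s = - (s' - s) by rewrite /c; ring.
  exact: transport_algebra E1.
rewrite [leRHS](_ : _ = a * (2 * (n%:R * 30)) * (s' - s) * (s' - s) +
  (a * (n%:R * 30 + n%:R * 30) + n%:R ^+ 2 * 60) * (s' - s) * (s' - s) +
  L * n%:R ^+ 2 * (s' - s) ^+ 2); last by rewrite /K; ring.
apply: (le_trans (ler_normB _ _)); apply: lerD => //.
by apply: (le_trans (ler_normD _ _)); exact: lerD.
Qed.

End flow.
End dynamics.

(** * Uniqueness for the forward equation *)

Section uniqueness.
Context {R : realType}.
Variables (a : R) (m : R -> probability R R).
Hypotheses (a_ge0 : 0 <= a) (km : subker m).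
Implicit Types (f h : R -> R) (r s t v x y b c : R).

Let moo s : (m s setT < +oo)%E. Proof. by apply: le1_lty; exact: km.2. Qed.

Lemma measurable_tail_indic d (T : measurableType d) (c x : T -> R) :
  measurable_fun setT c -> measurable_fun setT x ->
  bmeas (fun w => \1_(tail (c w)) (x w) : R).
Proof.
move=> mc mx; split.
  apply: (@measurable_fun_cvg _ _ _ _ (fun n w => psi n (c w) (x w))).
    by move=> n; exact: measurable_psi.
  by move=> w _; exact: psi_cvg.
by exists 1 => w; rewrite indicE; case: (_ \in _); rewrite ?normr1 ?normr0.
Qed.

Lemma continuous_itv_integrable f s t : continuous f ->
  (@lebesgue_measure R).-integrable `[s, t] (EFin \o f).
Proof.
move=> cf; apply: continuous_compact_integrable; first exact: segment_compact.
exact: continuous_subspaceT.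
Qed.

Lemma bmeas_tail b : bmeas (\1_(tail b) : R -> R).
Proof. by apply: measurable_tail_indic => //; exact: measurable_cst. Qed.

Section one_flow.
Variable nu : R -> {measure set R -> \bar R}.
Hypothesis knu : subker nu.

Let nuoo s : (nu s setT < +oo)%E. Proof. exact: le1_lty (knu.2 s). Qed.

(** The limit of [transport] when the test functions increase to the indicator of a
    half-line. *)
Definition tail_transport b t v : R := \int[nu v]_x
  (a * (jump m v (\1_(tail (b + t - v))) x - \1_(tail (b + t - v)) x)).

Lemma bmeas_tail_transport b t : bmeas (tail_transport b t).
Proof.
have bF : bmeas (fun p : R * R => \1_(tail (b + t - p.1)) p.2 : R).
  by apply: measurable_tail_indic; [exact: measurable_funB|exact: measurable_snd].
apply: (@bmeas_flow _ nu knu (fun p => a * (jump m p.1 (\1_(tail (b + t - p.1))) p.2 -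
  \1_(tail (b + t - p.1)) p.2))).
by apply: bmeasZ; apply: bmeasB => //; exact: (bmeas_jump2 km bF).
Qed.

Lemma integrated_tail r b t : integrated a m nu r -> r <= t -> 0 <= b ->
  \int[nu t]_x \1_(tail b) x = \int[nu r]_x \1_(tail (b + t - r)) x +
    tint (tail_transport b t) r t.
Proof.
move=> I rt b0.
have bpsi n c : bmeas (psi n c).
  by apply: bmeas_psi => //; exact: measurable_cst.
have lim_flow s c : \int[nu s]_x psi n c x @[n --> \oo] --> \int[nu s]_x \1_(tail c) x.
  apply: (@Rint_cvg _ _ _ (nu s) (nuoo s) _ _ 1).
  - by move=> n; case: (bpsi n c).
  - exact: bmeas_tail.
  - by move=> n x; exact: psi_bound.
  - by move=> x; exact: psi_cvg.
have lim_jump v c x :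
    jump m v (psi n c) x @[n --> \oo] --> jump m v (\1_(tail c)) x.
  apply: (@Rint_cvg _ _ _ (m v) (moo v) (fun n z => psi n c (x + z)) _ 1).
  - move=> n; apply: measurable_psi; first exact: measurable_cst.
    exact: measurable_funD.
  - by apply: (bmeas_comp (bmeas_tail c)); exact: measurable_funD.
  - by move=> n z; exact: psi_bound.
  - by move=> z; exact: psi_cvg.
have jb n v c x : `|a * (jump m v (psi n c) x - psi n c x)| <= a * (1 + 1).
  rewrite normrM ger0_norm// ler_wpM2l//; apply: (le_trans (ler_normB _ _)).
  by apply: lerD; [apply: jump_bound => // z; exact: psi_bound|exact: psi_bound].
have bt n v : bmeas (fun x => a * (jump m v (psi n (b + t - v)) x - psi n (b + t - v) x)).
  by apply: bmeasZ; apply: bmeasB => //; exact: bmeas_jump.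
have lim_tr v : transport a m nu n b t v @[n --> \oo] --> tail_transport b t v.
  apply: (@Rint_cvg _ _ _ (nu v) (nuoo v)
    (fun n x => a * (jump m v (psi n (b + t - v)) x - psi n (b + t - v) x)) _ (a * (1 + 1))).
  - by move=> n; case: (bt n v).
  - apply: bmeasZ; apply: bmeasB; last exact: bmeas_tail.
    by apply: bmeas_jump => //; exact: bmeas_tail.
  - by move=> n x; exact: jb.
  - move=> x; apply: cvgM; first exact: cvg_cst.
    by apply: cvgB; [exact: lim_jump|exact: psi_cvg].
have lim_tint : tint (transport a m nu n b t) r t @[n --> \oo] -->
    tint (tail_transport b t) r t.
  rewrite tintE; last exact: bmeas_tail_transport.
  rewrite (_ : (fun n => _) =
    fun n => \int[leb_on r t]_v transport a m nu n b t v); last first.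
    by apply/funext => n; rewrite tintE//; exact: bmeas_transport.
  apply: (@Rint_cvg _ _ _ (leb_on r t) (leb_on_lty r t) _ _ (a * (1 + 1))).
  - by move=> n; have [] := bmeas_transport a km knu n b t.
  - exact: bmeas_tail_transport.
  - move=> n v; rewrite /transport; apply: Rint_bound.
    + exact: knu.2.
    + exact: bt.
    + by rewrite mulr_ge0// addr_ge0.
    + by move=> x; exact: jb.
  - by move=> v; exact: lim_tr.
apply: (cvg_unique _ (lim_flow t b)) => //.
rewrite (_ : (fun n => _) = fun n => \int[nu r]_x psi n (b + t - r) x +
  tint (transport a m nu n b t) r t); first by apply: cvgD; [exact: lim_flow|].
by apply/funext => n; exact: integrated_transport.
Qed.

(** By Fubini the tails after a jump are averages of tails of nu: this closes the
    system of equations for the tails. *)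
Lemma tail_transportE b t v : tail_transport b t v =
  a * (\int[m v]_z \int[nu v]_x \1_(tail (b + t - v - z)) x -
       \int[nu v]_x \1_(tail (b + t - v)) x).
Proof.
have bj : bmeas (jump m v (\1_(tail (b + t - v)))).
  by apply: bmeas_jump => //; exact: bmeas_tail.
rewrite /tail_transport RintZ//; last by apply: bmeasB => //; exact: bmeas_tail.
rewrite RintB//; last exact: bmeas_tail.
congr (_ * (_ - _)).
have bF : bmeas (fun p : R * R => \1_(tail (b + t - v)) (p.1 + p.2) : R).
  by apply: (bmeas_comp (bmeas_tail _)); exact: measurable_addp.
rewrite /jump (@Rint_fubini _ _ _ _ _ _ _ _ (nuoo v) (moo v) bF).
apply: eq_Rintegral => z _; apply: eq_Rintegral => x _ /=.
have E : tail (b + t - v) (x + z) = tail (b + t - v - z) x.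
  by rewrite /tail/= !in_itv/= !andbT [in RHS]ltrBlDr.
by rewrite !indicE; congr (_%:R); congr nat_of_bool; apply/idP/idP; rewrite !inE E.
Qed.

End one_flow.

Lemma tint_expR l r t : 0 < l -> r <= t ->
  tint (fun v => expR (l * (v - r))) r t = (expR (l * (t - r)) - 1) / l.
Proof.
move=> l0; rewrite le_eqVlt => /predU1P[->|rt].
  by rewrite tint_point subrr mulr0 expR0 subrr mul0r.
pose F v := expR (l * (v - r)) / l.
have dl v : is_derive v (1 : R) (fun v => l * (v - r)) l.
  by apply: (@is_derive_quadratic _ _ _ _ 0) => y; rewrite mul0r normr_le0; apply/eqP; ring.
have de v : is_derive v (1 : R) (fun v => expR (l * (v - r))) (expR (l * (v - r)) * l).
  exact: (@is_derive1_comp R expR (fun v => l * (v - r)) v _ _ (is_derive_expR _) (dl v)).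
have dF v : is_derive v (1 : R) F (expR (l * (v - r))).
  have dg : is_derive (expR (l * (v - r))) (1 : R) (fun u => u / l) l^-1.
    by apply: (@is_derive_quadratic _ _ _ _ 0) => y; rewrite mul0r normr_le0; apply/eqP; ring.
  have := @is_derive1_comp R (fun u => u / l) (fun v => expR (l * (v - r))) v _ _ dg (de v).
  by rewrite mulrCA mulVf ?mulr1// gt_eqF.
have ce : continuous (fun v => expR (l * (v - r))) by exact: is_derive_continuous de.
have cF : continuous F by exact: is_derive_continuous dF.
rewrite /tint /Rintegral (@continuous_FTC2 R _ F)//.
- by rewrite /F /= subrr mulr0 expR0 -mulrBl.
- exact: continuous_subspaceT.
- split.
  + by move=> v _; have [] := dF v.
  + by apply: cvg_at_right_filter; exact: cF.
  + by apply: cvg_at_left_filter; exact: cF.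
- by move=> v _; rewrite derive1E; have [_ ->] := dF v.
Qed.

Section two_flows.
Variables nu nu' : R -> {measure set R -> \bar R}.
Hypotheses (knu : subker nu) (knu' : subker nu').
Hypotheses (cnu : forall s, conc (nu s)) (cnu' : forall s, conc (nu' s)).
Variable r : R.
Hypotheses (I : integrated a m nu r) (I' : integrated a m nu' r).
Hypothesis init : forall U, measurable U -> nu r U = nu' r U.

Let nuoo s : (nu s setT < +oo)%E. Proof. exact: le1_lty (knu.2 s). Qed.
Let nuoo' s : (nu' s setT < +oo)%E. Proof. exact: le1_lty (knu'.2 s). Qed.

Let T s b : R := \int[nu s]_x \1_(tail b) x.
Let T' s b : R := \int[nu' s]_x \1_(tail b) x.

Let initE h : \int[nu r]_x h x = \int[nu' r]_x h x.
Proof. by congr fine; apply: eq_measure_integral => A mA _; exact: init. Qed.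

Let mass t : r <= t -> \int[nu t]_x 1 = \int[nu' t]_x 1.
Proof.
by move=> rt; rewrite (integrated_mass I)// (integrated_mass I')// initE.
Qed.

(* Below the origin the tails are total masses, which are conserved. *)
Let tail_neg t b : r <= t -> b < 0 -> T t b = T' t b.
Proof.
move=> rt b0; rewrite /T /T'.
have E (k : {measure set R -> \bar R}) : (k setT < +oo)%E -> conc k ->
    \int[k]_x \1_(tail b) x = \int[k]_x 1 :> R.
  move=> koo ck; apply: conc_eq_Rint => //; [exact: bmeas_tail|exact: bmeas_cst|].
  by move=> x x0; rewrite indicE mem_set// /tail/= in_itv/= andbT (lt_le_trans b0).
by rewrite !E// mass.
Qed.

(* The tail equation has Lipschitz constant 2a in the supremum norm; integrating
   exp (l (v - r)) gains a factor 1 / l, so that l >= 4a yields a factor 1/2, and the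
   summand 1 keeps l positive when a = 0. *)
Let l : R := 4 * a + 1.

Let contraction n t b : r <= t -> `|T t b - T' t b| <= 2 / 2 ^+ n * expR (l * (t - r)).
Proof.
have l0 : 0 < l by rewrite ltr_wpDl// mulr_ge0.
have Tb s c : `|T s c| <= 1.
  apply: Rint_bound => //; [exact: knu.2|exact: bmeas_tail|].
  by move=> x; rewrite indicE; case: (_ \in _); rewrite ?normr1 ?normr0.
have Tb' s c : `|T' s c| <= 1.
  apply: Rint_bound => //; [exact: knu'.2|exact: bmeas_tail|].
  by move=> x; rewrite indicE; case: (_ \in _); rewrite ?normr1 ?normr0.
elim: n t b => [|n IH] t b rt.
  rewrite expr0 divr1 (@le_trans _ _ (1 + 1))//.
    by apply: (le_trans (ler_normB _ _)); exact: lerD.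
  rewrite ler_peMr// -expR0 ler_expR mulr_ge0// ?subr_ge0// ltW//.
have B0 : 0 <= 2 / 2 ^+ n.+1 * expR (l * (t - r)).
  by rewrite mulr_ge0 ?expR_ge0// divr_ge0// exprn_ge0.
have [b0|b0] := leP 0 b; last by rewrite tail_neg// subrr normr0.
rewrite /T /T' (integrated_tail knu I)// (integrated_tail knu' I')// initE.
rewrite opprD addrACA subrr add0r -tintB; last 2 first.
- by apply: bmeas_itv_integrable; exact: bmeas_tail_transport.
- by apply: bmeas_itv_integrable; exact: bmeas_tail_transport.
pose B : R := 2 / 2 ^+ n.
have B1 : 0 <= B by rewrite divr_ge0// exprn_ge0.
pose g v := a * (2 * B) * expR (l * (v - r)).
have ce : continuous (fun v => expR (l * (v - r))).
  move=> v; apply: (@continuous_comp _ _ _ (fun v => l * (v - r)) expR).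
    apply: cvgM; first exact: cvg_cst.
    by apply: cvgB; [exact: cvg_id|exact: cvg_cst].
  exact: continuous_expR.
have ig : (@lebesgue_measure R).-integrable `[r, t] (EFin \o g).
  apply: continuous_itv_integrable => v.
  by apply: cvgM; [exact: cvg_cst|exact: ce].
have bd : bmeas (fun v => tail_transport nu b t v - tail_transport nu' b t v).
  by apply: bmeasB; exact: bmeas_tail_transport.
have gP v : r <= v <= t -> `|tail_transport nu b t v - tail_transport nu' b t v| <= g v.
  move=> /andP[rv vt]; rewrite !tail_transportE// -mulrBr.
  rewrite normrM (ger0_norm a_ge0) /g -mulrA ler_wpM2l//.
  have bz (k : R -> {measure set R -> \bar R}) : subker k ->
      bmeas (fun z : R => \int[k v]_x \1_(tail (b + t - v - z)) x : R).
    move=> kk; have kk' : subker (fun _ : R => k v).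
      by split => [U mU|_]; [exact: measurable_cst|exact: kk.2].
    apply: (@subker_bmeas _ _ _ _ _ _ (fun p : R * R => \1_(tail (b + t - v - p.1)) p.2) kk').
    by apply: measurable_tail_indic; [exact: measurable_funB|exact: measurable_snd].
  rewrite (_ : _ - _ = (\int[m v]_z T v (b + t - v - z) - \int[m v]_z T' v (b + t - v - z)) -
    (T v (b + t - v) - T' v (b + t - v))); last by rewrite /T /T'; ring.
  have -> : 2 * B * expR (l * (v - r)) = B * expR (l * (v - r)) + B * expR (l * (v - r)).
    by ring.
  apply: (le_trans (ler_normB _ _)); apply: lerD; last exact: IH.
  rewrite -(RintB (moo v)); try exact: bz.
  apply: Rint_bound; first exact: km.2.
  - by apply: bmeasB; exact: bz.
  - by rewrite mulr_ge0// expR_ge0.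
  - by move=> z; exact: IH.
rewrite [leRHS](_ : _ = B / 2 * expR (l * (t - r))); last first.
  by rewrite /B exprS; field; rewrite expf_neq0.
apply: (@le_trans _ _ (tint g r t)).
  have h1 : tint (fun v => tail_transport nu b t v - tail_transport nu' b t v) r t <=
      tint g r t.
    apply: tint_le => //; first exact: bmeas_itv_integrable.
    by move=> v /gP; apply: le_trans; exact: ler_norm.
  have h2 : tint (fun v =>
      -1 * (tail_transport nu b t v - tail_transport nu' b t v)) r t <= tint g r t.
    apply: tint_le => //; first by apply: bmeas_itv_integrable; exact: bmeasZ.
    by move=> v /gP; apply: le_trans; rewrite mulN1r; by rewrite -normrN ler_norm.
  rewrite ler_norml h1 andbT lerNl -mulN1r -tintZ//; exact: bmeas_itv_integrable.
rewrite /g tintZ//; last exact: continuous_itv_integrable.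
rewrite tint_expR// mulrA ler_pdivrMr//; set e := expR _.
rewrite -subr_ge0 (_ : _ - _ = 2 * (a * B) + B * e / 2); last by rewrite /l; field.
by rewrite addr_ge0// ?divr_ge0// mulr_ge0// ?expR_ge0// mulr_ge0.
Qed.

Lemma flow_tail_unique t b : r <= t -> nu t (tail b) = nu' t (tail b).
Proof.
move=> rt; have e0 : 0 <= expR (l * (t - r)) := expR_ge0 _.
have TE : T t b = T' t b.
  apply/eqP; rewrite -subr_eq0 -normr_le0; apply/ler_addgt0Pr => eps eps0; rewrite add0r.
  set e := expR (l * (t - r)) in e0.
  pose n := Num.truncn (2 * e / eps).
  apply: (le_trans (contraction n b rt)); rewrite -/e mulrAC ler_pdivrMr ?exprn_gt0//.
  rewrite -ler_pdivrMl// mulrC (@le_trans _ _ n.+1%:R)//; first exact/ltW/truncnS_gt.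
  by rewrite -natrX ler_nat ltn_expl.
move: TE; rewrite /T /T' !Rint_indic; try exact: measurable_tail.
have fin (k : {measure set R -> \bar R}) : (k setT < +oo)%E -> k (tail b) \is a fin_num.
  move=> koo; rewrite ge0_fin_numE//; apply: le_lt_trans koo.
  by rewrite le_measure ?inE//; exact: measurable_tail.
move=> E; have := congr1 EFin E.
by rewrite !fineK//; exact: fin.
Qed.

Lemma flow_unique t h : r <= t -> \int[nu t]_x h x = \int[nu' t]_x h x.
Proof.
move=> rt; congr fine; apply: eq_measure_integral => A mA _.
apply: tail_unique => // [|b]; last exact: flow_tail_unique.
have := mass rt; rewrite !Rintegral_cst// !mul1r => E.
by have := congr1 EFin E; rewrite !fineK// ge0_fin_numE.
Qed.

End two_flows.
End uniqueness.

(** * The mild equation implies the forward equation *)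

Section exponential_bounds.
Context {R : realType}.
Implicit Types x : R.

Lemma expRN_le1 x : 0 <= x -> 0 <= 1 - expR (- x) <= x.
Proof.
move=> x0; have h1 := expR_ge1Dx (- x).
have h2 : expR (- x) <= 1 by rewrite -expR0 ler_expR oppr_le0.
by apply/andP; split; lra.
Qed.

Lemma expRN_quadratic x : 0 <= x -> `|expR (- x) - 1 + x| <= x ^+ 2.
Proof.
move=> x0; have h1 := expR_ge1Dx (- x).
rewrite ger0_norm; last lra.
have h2 : expR (- x) * (1 + x) <= 1.
  rewrite expRN mulrC ler_pdivrMr ?expR_gt0// mul1r; exact: expR_ge1Dx.
have h3 : 0 <= (1 - expR (- x)) * x.
  by rewrite mulr_ge0//; have /andP[] := expRN_le1 x0.
have : expR (- x) - 1 + x <= (1 - expR (- x)) * x.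
  by move: h2; rewrite mulrDr mulr1 mulrBl mul1r; lra.
move/le_trans; apply; rewrite expr2 ler_wpM2r//.
by have /andP[] := expRN_le1 x0.
Qed.

End exponential_bounds.

(** The bookkeeping of [mild_restart], with integrals as atoms. *)
Lemma restart_algebra (R : realType) (e1 e2 a A T T' : R) :
  e1 * e2 * A + a * (e1 * T + T') = e1 * (e2 * A + a * T) + a * T'.
Proof. by ring. Qed.

Section mild_equation.
Context {R : realType}.
Variables (a : R) (m : R -> probability R R).
Hypotheses (a_ge0 : 0 <= a) (km : subker m).
Implicit Types (f h : R -> R) (s t v x y b c : R).
Notation leb := (@lebesgue_measure R).

Definition mild_integrand (nu : R -> {measure set R -> \bar R}) h t v : R :=
  expR (a * (v - t)) * \int[nu v]_x jump m v (drift (t - v) h) x.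

Definition mild (r : R) (nu : R -> {measure set R -> \bar R}) : Prop :=
  forall h t, bmeas h -> r <= t ->
    leb.-integrable `[r, t] (EFin \o mild_integrand nu h t) /\
    \int[nu t]_x ext h x = expR (a * (r - t)) * \int[nu r]_x drift (t - r) h x +
      a * tint (mild_integrand nu h t) r t.

Variables (r : R) (nu : R -> {measure set R -> \bar R}).
Hypotheses (nu1 : forall t, r <= t -> (nu t setT <= 1)%E) (M : mild r nu).

Lemma mild_integrand_bound h K t v : bmeas h -> (forall x, `|h x| <= K) ->
  r <= v -> v <= t -> `|mild_integrand nu h t v| <= K.
Proof.
move=> bh hK rv vt; have K0 := le_trans (normr_ge0 _) (hK 0).
have bd : bmeas (drift (t - v) h) by exact: bmeas_drift.
rewrite normrM ger0_norm ?expR_ge0// -[leRHS]mul1r; apply: ler_pM => //.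
  by rewrite -expR0 ler_expR mulr_ge0_le0// subr_le0.
apply: Rint_bound => //; [exact: nu1|exact: bmeas_jump|].
by move=> x; apply: jump_bound => // y; exact: hK.
Qed.

(** The equation at time s for the test function T_(t-s) h, combined with the
    semigroup property of T, restarts the equation at s. *)
Lemma mild_restart h s t : bmeas h -> r <= s -> s <= t ->
  leb.-integrable `[s, t] (EFin \o mild_integrand nu h t) /\
  \int[nu t]_x ext h x = expR (a * (s - t)) * \int[nu s]_x drift (t - s) h x +
    a * tint (mild_integrand nu h t) s t.
Proof.
move=> bh rs st; have rt := le_trans rs st.
have [it Et] := M bh rt.
have ist : leb.-integrable `[s, t] (EFin \o mild_integrand nu h t).
  by apply: integrableS it => //; apply: subset_itvr; rewrite bnd_simp.
split => //; rewrite Et (tint_cat rs st it).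
have ts0 : 0 <= t - s by rewrite subr_ge0.
have [is_ Es] := M (bmeas_drift (t - s) bh) rs.
have Ed : ext (drift (t - s) h) = drift (t - s) h by rewrite -drift0 drift_drift// add0r.
have Ed' : drift (s - r) (drift (t - s) h) = drift (t - r) h.
  rewrite drift_drift//.
  by have -> : s - r + (t - s) = t - r by ring.
rewrite Ed Ed' in Es.
have E : tint (mild_integrand nu h t) r s =
    expR (a * (s - t)) * tint (mild_integrand nu (drift (t - s) h) s) r s.
  rewrite -tintZ//; apply: eq_tint => v _.
  have -> : mild_integrand nu (drift (t - s) h) s v =
      expR (a * (v - s)) * \int[nu v]_x jump m v (drift (t - v) h) x.
    have Ev : drift (s - v) (drift (t - s) h) = drift (t - v) h.
      rewrite drift_drift//.
      by have -> : s - v + (t - s) = t - v by ring.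
    by rewrite /mild_integrand Ev.
  rewrite /mild_integrand mulrA -expRD.
  by have -> : a * (s - t) + a * (v - s) = a * (v - t) by ring.
have e : expR (a * (r - t)) = expR (a * (s - t)) * expR (a * (r - s)).
  by rewrite -expRD; congr expR; ring.
by rewrite E Es e; exact: restart_algebra.
Qed.

(** On a short interval nu moves as the pure drift, up to the probability, of order
    [t - s], that a jump occurs. This holds for every bounded measurable h, and is
    what allows f' to be merely bounded and continuous in [mild_integrated]. *)
Lemma mild_close h K s t : bmeas h -> (forall x, `|h x| <= K) -> r <= s -> s <= t ->
  `|\int[nu t]_x ext h x - \int[nu s]_x drift (t - s) h x| <= 2 * a * K * (t - s).
Proof.
move=> bh hK rs st; have [ist ->] := mild_restart bh rs st.
have K0 := le_trans (normr_ge0 _) (hK 0).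
have ts0 : 0 <= t - s by rewrite subr_ge0.
set A := \int[nu s]_x _.
have AK : `|A| <= K.
  by apply: Rint_bound; [exact: nu1|exact: bmeas_drift|exact: K0|move=> x; exact: hK].
have -> : 2 * a * K * (t - s) = a * (t - s) * K + a * (K * (t - s)) by ring.
have -> : expR (a * (s - t)) * A + a * tint (mild_integrand nu h t) s t - A =
    - ((1 - expR (- (a * (t - s)))) * A) + a * tint (mild_integrand nu h t) s t.
  have -> : a * (s - t) = - (a * (t - s)) by ring.
  by set T := tint _ _ _; ring.
apply: (le_trans (ler_normD _ _)); apply: lerD.
  have /andP[e0 e1] := expRN_le1 (mulr_ge0 a_ge0 ts0).
  by rewrite normrN normrM ger0_norm//; apply: ler_pM.
rewrite normrM ger0_norm// ler_wpM2l//; apply: tint_bound => //.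
move=> v /andP[sv vt]; apply: mild_integrand_bound => //; exact: le_trans sv.
Qed.

Lemma mild_lip f K N s t : bounded_C1 f -> (forall x, `|ext f x| <= K) ->
  (forall x, `|Dr f x| <= N) -> r <= s -> s <= t ->
  `|\int[nu t]_x ext f x - \int[nu s]_x ext f x| <= (2 * a * K + N) * (t - s).
Proof.
move=> fC fK fN rs st; have be := bounded_C1_bmeas fC.
have N0 := le_trans (normr_ge0 _) (fN 0).
have ts0 : 0 <= t - s by rewrite subr_ge0.
have h : `|\int[nu t]_x ext f x - \int[nu s]_x drift (t - s) f x| <= 2 * a * K * (t - s).
  have Ee : ext (ext f) = ext f by rewrite -[LHS]drift0 drift_ext drift0.
  by have := mild_close be fK rs st; rewrite Ee drift_ext.
rewrite mulrDl (_ : _ - _ = (\int[nu t]_x ext f x - \int[nu s]_x drift (t - s) f x) +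
  (\int[nu s]_x drift (t - s) f x - \int[nu s]_x ext f x)); last by ring.
apply: (le_trans (ler_normD _ _)); apply: lerD => //.
have bd : bmeas (drift (t - s) f) by rewrite -drift_ext; exact: bmeas_drift.
rewrite -RintB//; last exact/le1_lty/nu1.
apply: Rint_bound; [exact: nu1|exact: bmeasB|exact: mulr_ge0|].
by move=> x; exact: drift_lip.
Qed.

End mild_equation.

(** The bookkeeping of [mild_integrated], with integrals as atoms: each summand on
    the right is of second order in the length dl of the time interval. *)
Lemma generator_algebra (R : realType) (a e dl A Ns N' T1 TJ TN TD TS : R) :
  N' = e * A + a * T1 -> A - Ns = - TS ->
  N' - Ns - (a * (TJ - TN) - TD) =
  (e - 1 + a * dl) * A + (TD - TS) - a * dl * (A - Ns) + a * (TN - dl * Ns)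
    + a * (T1 - TJ).
Proof. by move=> -> /eqP; rewrite subr_eq => /eqP ->; ring. Qed.

Section mild_to_integrated.
Context {R : realType}.
Variables (a : R) (m : R -> probability R R).
Hypotheses (a_ge0 : 0 <= a) (km : subker m).
Implicit Types (f h : R -> R) (s t v x y b c : R).
Notation leb := (@lebesgue_measure R).
Variables (r : R) (nu : R -> {measure set R -> \bar R}).
Hypotheses (knu : subker nu) (M : mild a m r nu).

Let nuoo s : (nu s setT < +oo)%E. Proof. exact: le1_lty (knu.2 s). Qed.
Let nu1 t : r <= t -> (nu t setT <= 1)%E. Proof. by move=> _; exact: knu.2. Qed.

(** Over [s, s'] the mild equation and the forward equation differ by five terms of
    order (s' - s)^2: the exponential minus its linear part, the drift term evaluated
    along nu rather than along the pure drift, the product of the loss rate and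
    the drift, the loss term frozen at time s, and the gain term stripped of its
    weight and drift. *)
Lemma mild_integrated : integrated a m nu r.
Proof.
move=> f t fC rt.
have be := bounded_C1_bmeas fC; have bD := bmeas_Dr fC.
have [K fK] := be.2; have [N fN] := bD.2.
have K0 : 0 <= K := le_trans (normr_ge0 _) (fK 0).
have N0 : 0 <= N := le_trans (normr_ge0 _) (fN 0).
pose g v := \int[nu v]_x gen a m v f x.
have bg : bmeas g by apply: bmeas_flow_gen.
pose n v := \int[nu v]_x ext f x.
pose H s := n s - tint g r s.
pose C : R := a ^+ 2 * K + 2 * a * N + a * N + a * (2 * a * K + N) + a * (a * K + N).
suff : H t = H r.
  by rewrite /H tint_point subr0 => /eqP; rewrite subr_eq => /eqP.
apply: (@quadratic_const _ H C r t rt) => s s' rs ss' s't.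
have -> : H s' - H s = n s' - n s - tint g s s'.
  rewrite /H (@tint_cat _ g r s s')//; last exact: bmeas_itv_integrable.
  by set x := tint _ _ _; set y := tint _ _ _; ring.
have d0 : 0 <= s' - s by rewrite subr_ge0.
have ad0 : 0 <= a * (s' - s) by rewrite mulr_ge0.
pose j v := \int[nu v]_x jump m v (ext f) x.
pose dr v := \int[nu v]_x Dr f x.
pose st v := \int[nu s]_x drift (v - s) (Dr f) x.
pose A := \int[nu s]_x drift (s' - s) f x.
have bj : bmeas j.
  apply: (@bmeas_flow _ nu knu (fun p => jump m p.1 (ext f) p.2)).
  exact: (bmeas_jump2 km (bmeas_snd be)).
have bn : bmeas n by apply: (@bmeas_flow _ nu knu (fun p => ext f p.2)); exact: bmeas_snd.
have bdr : bmeas dr by apply: (@bmeas_flow _ nu knu (fun p => Dr f p.2)); exact: bmeas_snd.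
have bdF : bmeas (fun p : R * R => drift (p.1 - s) (Dr f) p.2).
  apply: (bmeas_comp bD); apply: measurable_maxr => //.
  apply: measurable_funB; first exact: measurable_snd.
  by apply: measurable_funB; [exact: measurable_fst|exact: measurable_cst].
have bst : bmeas st.
  apply: (@subker_bmeas _ _ _ _ _ (fun _ : R => nu s) (fun p => drift (p.1 - s) (Dr f) p.2)) bdF.
  by split => [U mU|_]; [exact: measurable_cst|exact: knu.2].
have bdr' : bmeas (drift (s' - s) f) by rewrite -drift_ext; exact: bmeas_drift.
have Eg : tint g s s' = a * (tint j s s' - tint n s s') - tint dr s s'.
  rewrite -(@tintB _ j n); [|exact: bmeas_itv_integrable..].
  rewrite -tintZ; last by apply: bmeas_itv_integrable; exact: bmeasB.
  rewrite -tintB; [|by apply: bmeas_itv_integrable; apply: bmeasZ; exact: bmeasB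
    |exact: bmeas_itv_integrable].
  apply: eq_tint => v _; rewrite /g /j /n /dr /gen.
  have bjv : bmeas (jump m v (ext f)) by exact: bmeas_jump.
  rewrite (RintB (nuoo v)) //; last by apply: bmeasZ; exact: bmeasB.
  by rewrite (RintZ (nuoo v)) ?(RintB (nuoo v))//; exact: bmeasB.
have Ee : ext (ext f) = ext f by rewrite -[LHS]drift0 drift_ext drift0.
have [is1 E1] := mild_restart M be rs ss'.
rewrite Ee drift_ext in E1.
have Ee' : expR (a * (s - s')) = expR (- (a * (s' - s))) by congr expR; ring.
have E2 : A - n s = - tint st s s'.
  rewrite /A /n -RintB//.
  rewrite (@eq_Rintegral _ _ _ _ _
    (fun x => -1 * tint (fun v => drift (v - s) (Dr f) x) s s')); last first.
    by move=> x _; rewrite mulN1r -drift_FTC.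
  have bx x : bmeas (fun v => drift (v - s) (Dr f) x).
    exact: (@bmeas_comp _ _ _ _ _ (fun p : R * R => drift (p.1 - s) (Dr f) p.2)
      (fun v => (v, x)) bdF (pair2_measurable x)).
  have bt : bmeas (fun x => tint (fun v => drift (v - s) (Dr f) x) s s').
    have -> : (fun x => tint (fun v => drift (v - s) (Dr f) x) s s') =
        fun x => - (drift (s' - s) f x - ext f x).
      by apply/funext => x; rewrite drift_FTC// opprK.
    by apply: bmeasN; exact: bmeasB.
  rewrite (RintZ (nuoo s))// mulN1r; congr (- _).
  by rewrite -(@tint_fubini _ _ _ (nu s) (fun p => drift (p.1 - s) (Dr f) p.2)).
rewrite Eg (generator_algebra (s' - s) (tint j s s') (tint n s s') (tint dr s s') E1 E2) Ee'.
have AK : `|A| <= K.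
  by apply: Rint_bound; [exact: knu.2|exact: bdr'|exact: K0|move=> x; exact: fK].
have An : `|A - n s| <= N * (s' - s).
  rewrite /A /n -RintB//; apply: Rint_bound; [exact: knu.2|exact: bmeasB|exact: mulr_ge0|].
  by move=> x; exact: drift_lip.
have B1 : `|(expR (- (a * (s' - s))) - 1 + a * (s' - s)) * A| <=
    (a ^+ 2 * K) * (s' - s) ^+ 2.
  rewrite normrM (_ : _ * K * _ = (a * (s' - s)) ^+ 2 * K); last by ring.
  by apply: ler_pM => //; exact: expRN_quadratic.
have B2 : `|tint dr s s' - tint st s s'| <= (2 * a * N) * (s' - s) ^+ 2.
  rewrite expr2 mulrA; apply: tint_close => //; [exact: bmeas_itv_integrable..|].
  move=> v /andP[sv vs'].
  have Ed : ext (Dr f) = Dr f.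
    apply/funext => x; have [x0|x0] := leP 0 x; first by rewrite ext_id.
    by rewrite /ext max_r ?(ltW x0)// !Dr_le0// ltW.
  have := mild_close a_ge0 km nu1 M bD fN rs sv; rewrite Ed => /le_trans; apply.
  by rewrite ler_wpM2l ?lerB// mulr_ge0// mulr_ge0.
have B3 : `|a * (s' - s) * (A - n s)| <= (a * N) * (s' - s) ^+ 2.
  rewrite normrM (ger0_norm ad0) (_ : _ * N * _ = a * (s' - s) * (N * (s' - s))); last by ring.
  by rewrite ler_wpM2l.
have B4 : `|a * (tint n s s' - (s' - s) * n s)| <= (a * (2 * a * K + N)) * (s' - s) ^+ 2.
  rewrite normrM (ger0_norm a_ge0) -[leRHS]mulrA ler_wpM2l//.
  rewrite [(s' - s) * _]mulrC -tint_cst// expr2 mulrA; apply: tint_close => //.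
  - exact: bmeas_itv_integrable.
  - by apply: bmeas_itv_integrable; exact: bmeas_cst.
  move=> v /andP[sv vs'].
  apply: (le_trans (mild_lip a_ge0 km nu1 M fC fK fN rs sv)).
  by rewrite ler_wpM2l ?lerB// addr_ge0// mulr_ge0// mulr_ge0.
have B5 : `|a * (tint (mild_integrand a m nu (ext f) s') s s' - tint j s s')| <=
    (a * (a * K + N)) * (s' - s) ^+ 2.
  rewrite normrM (ger0_norm a_ge0) -[leRHS]mulrA ler_wpM2l//.
  rewrite expr2 mulrA; apply: tint_close => //; first exact: bmeas_itv_integrable.
  move=> v /andP[sv vs'].
  have vd0 : 0 <= s' - v by rewrite subr_ge0.
  have bdv : bmeas (drift (s' - v) f) by rewrite -drift_ext; exact: bmeas_drift.
  have bjd : bmeas (jump m v (drift (s' - v) f)) by exact: bmeas_jump.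
  have bje : bmeas (jump m v (ext f)) by exact: bmeas_jump.
  rewrite /mild_integrand drift_ext /j; set X := \int[nu v]_x _; set Y := \int[nu v]_x _.
  have -> : a * (v - s') = - (a * (s' - v)) by ring.
  have XK : `|X| <= K.
    apply: Rint_bound; [exact: knu.2|exact: bjd|exact: K0|].
    by move=> x; apply: jump_bound => // y; exact: fK.
  have XY : `|X - Y| <= N * (s' - v).
    rewrite /X /Y -RintB//.
    apply: Rint_bound; [exact: knu.2|exact: bmeasB|exact: mulr_ge0|].
    move=> x; rewrite -jumpB//; apply: jump_bound => //; first exact: bmeasB.
    by move=> y; exact: drift_lip.
  have ea0 : 0 <= a * (s' - v) by rewrite mulr_ge0.
  rewrite (_ : _ - _ = - ((1 - expR (- (a * (s' - v)))) * X) + (X - Y)); last by ring.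
  apply: (@le_trans _ _ ((a * K + N) * (s' - v))).
    rewrite [leRHS]mulrDl; apply: (le_trans (ler_normD _ _)); apply: (lerD _ XY).
    rewrite normrN normrM mulrAC; have /andP[e0 e1] := expRN_le1 ea0.
    by rewrite (ger0_norm e0); apply: ler_pM.
  by rewrite ler_wpM2l ?lerB// addr_ge0// mulr_ge0.
rewrite [leRHS](_ : _ = a ^+ 2 * K * (s' - s) ^+ 2 + 2 * a * N * (s' - s) ^+ 2 +
  a * N * (s' - s) ^+ 2 + a * (2 * a * K + N) * (s' - s) ^+ 2 +
  a * (a * K + N) * (s' - s) ^+ 2); last by rewrite /C; ring.
apply: (le_trans (ler_normD _ _)); apply: lerD; last exact: B5.
apply: (le_trans (ler_normD _ _)); apply: lerD; last exact: B4.
apply: (le_trans (ler_normB _ _)); apply: lerD; last exact: B3.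
by apply: (le_trans (ler_normD _ _)); exact: (lerD B1 B2).
Qed.

End mild_to_integrated.

(** * The laws of the model are kernels *)

Section psi_kernels.
Context {R : realType}.

Lemma max_lip (r s u : R) : s <= u -> Num.max r u - Num.max r s <= u - s.
Proof. by move=> su; case: (leP r u) => ru; case: (leP r s) => rs; lra. Qed.

Lemma right_cvg_lip (f : R -> R) (x C : R) :
  (forall y, x < y -> `|f y - f x| <= C * (y - x)) -> f y @[y --> x^'+] --> f x.
Proof.
move=> h; have C0 : 0 <= C.
  have := h (x + 1); rewrite ltrDl ltr01 addrAC subrr add0r mulr1 => /(_ erefl).
  exact: (le_trans (normr_ge0 _)).
apply/cvgrPdist_lt => e e0; near=> y.
have xy : x < y by near: y; exact: nbhs_right_gt.
rewrite distrC; apply: (le_lt_trans (h _ xy)).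
apply: (@le_lt_trans _ _ ((C + 1) * (y - x))).
  by rewrite ler_wpM2r ?subr_ge0 ?ltW// ltrDl.
rewrite mulrC -ltr_pdivlMr ?ltr_wpDl// ltrBlDl.
by near: y; apply: nbhs_right_lt; rewrite ltrDl divr_gt0// ltr_wpDl.
Unshelve. all: by end_near. Qed.

Lemma has_deriv_right_cvg (f : R -> R) (x l : R) : 0 <= x -> has_deriv f x l ->
  f y @[y --> x^'+] --> f x.
Proof.
move=> x0 /has_derivP/(_ 1 ltr01)[r r0 rP].
pose g y := if y < x + r then f y else f x.
have gx : g x = f x by rewrite /g ltrDl r0.
have cg : g y @[y --> x^'+] --> g x.
  apply: (@right_cvg_lip _ _ (`|l| + 1)) => y xy; rewrite gx /g.
  case: ifPn => [yr|_]; last first.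
    by rewrite subrr normr0; apply: mulr_ge0; [exact: addr_ge0|rewrite subr_ge0 ltW].
  have yx : y != x by rewrite gt_eqF.
  have y0 : 0 <= y - x by rewrite subr_ge0 ltW.
  have := rP y (le_trans x0 (ltW xy)) yx; rewrite (ger0_norm y0) ltrBlDl => /(_ yr).
  move=> /ltW dl; rewrite (_ : f y - f x = diff_quot f x y * (y - x)); last first.
    by rewrite /diff_quot divfK// subr_eq0.
  rewrite normrM (ger0_norm y0) ler_wpM2r// addrC -lerBlDr.
  exact: (le_trans (lerB_dist _ _)).
rewrite -gx; apply: cvg_trans cg; apply: near_eq_cvg; near=> y.
rewrite /g ifT//; near: y; apply: nbhs_right_lt; by rewrite ltrDl.
Unshelve. all: by end_near. Qed.

(** The indicators of half-lines are bounded pointwise limits of the functions [psi],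
    and half-lines generate the Borel sets. *)
Lemma psi_subker d (T : measurableType d) (k : T -> {measure set R -> \bar R}) :
  (forall w, k w setT = 1%E) -> (forall w, conc (k w)) ->
  (forall n b, 0 <= b -> measurable_fun setT (fun w => \int[k w]_x psi n b x)) ->
  subker k.
Proof.
move=> k1 kc kpsi.
have koo w : (k w setT < +oo)%E by rewrite k1 ltry.
have bpsi n b : bmeas (psi n b : R -> R).
  by apply: bmeas_psi => //; exact: measurable_cst.
split => [|w]; last by rewrite k1.
apply: tail_measurable => //.
  by under eq_fun do rewrite k1; exact: measurable_cst.
move=> b.
have E w : k w (tail b) = (\int[k w]_x \1_(tail b) x)%:E.
  rewrite Rint_indic//; last exact: measurable_tail.
  rewrite fineK// ge0_fin_numE//; apply: le_lt_trans (koo w).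
  by rewrite le_measure ?inE//; exact: measurable_tail.
under eq_fun do rewrite E.
apply/measurable_EFinP; have [b0|b0] := leP 0 b.
  apply: (@measurable_fun_cvg _ _ _ _ (fun n w => \int[k w]_x psi n b x)).
    by move=> n; exact: kpsi.
  move=> w _; apply: (@Rint_cvg _ _ _ (k w) (koo w) _ _ 1).
  - by move=> n; case: (bpsi n b).
  - exact: bmeas_tail.
  - by move=> n x; exact: psi_bound.
  - by move=> x; exact: psi_cvg.
apply: (eq_measurable_fun (fun _ : T => 1 : R)); last exact: measurable_cst.
move=> w _; rewrite (@conc_eq_Rint _ _ _ (fun _ => 1))//.
- by rewrite Rintegral_cst// k1 mulr1.
- exact: bmeas_tail.
- exact: bmeas_cst.
move=> x x0; rewrite indicE mem_set// /tail/= in_itv/= andbT.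
exact: lt_le_trans x0.
Qed.

End psi_kernels.

Section CDR_kernels.
Context {R : realType}.
Variables (a : R) (q : posdist R) (mu : R -> probability R R).
Variables (P : R -> R -> R.-pker R ~> R).
Hypotheses (a_ge0 : 0 <= a) (mu_CDR : generalized_CDR a q mu).
Hypothesis P_semigroup : CDR_semigroup a q mu P.
Implicit Types (f h : R -> R) (r s t v x : R).

Lemma prob_mass (p : probability R R) : (p : {measure set R -> \bar R}) setT = 1%E.
Proof. exact: probability_setT. Qed.

Lemma mu_conc s : 0 <= s -> conc (mu s).
Proof.
by move=> s0; apply: on_Rp_conc; [exact: prob_mass|exact: mu_CDR.1].
Qed.

Lemma pairingE (p : {measure set R -> \bar R}) f : (p setT < +oo)%E -> conc p ->
  bounded_borel f -> pairing p f = \int[p]_x ext f x.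
Proof.
move=> poo pc bf; rewrite conc_Rint//; last exact: bmeas_ext.
apply: eq_Rintegral => x; rewrite inE /Rp/= in_itv/= andbT => x0.
by rewrite ext_id.
Qed.

(** For b >= 0 the functions [psi n b] lie in bC1_*, so that their integrals are
    differentiable, hence right-continuous, in time. *)
Lemma mu_subker : subker (fun s => mu (Num.max s 0)).
Proof.
apply: psi_subker.
- by move=> s; exact: prob_mass.
- by move=> s; apply: mu_conc; exact: max0_ge0.
move=> n b b0.
pose Y s (_ : unit) := pairing (mu s) (psi n b).
have mY : measurable_fun setT (fun z : R * unit => Y (Num.max z.1 0) z.2).
  apply: measurable_right_continuous => [s _|s w s0]; first exact: measurable_cst.
  exact: (has_deriv_right_cvg s0 (mu_CDR.2 _ (psi_C1_star n b0) _ s0)).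
have mp : measurable_fun setT (fun s : R => (s, tt)) by exact: pair2_measurable.
have := measurableT_comp mY mp; apply: eq_measurable_fun => s _ /=.
rewrite /Y pairingE.
- by rewrite ext_psi.
- by apply: le1_lty; exact: sprobability_setT.
- by apply: mu_conc; exact: max0_ge0.
- by apply: bounded_C1_borel; exact: (psi_C1 n b).1.
Qed.

(** The jump law mu_s^q, with times clipped at 0 so as to be a kernel on the whole
    line. *)
Definition jump_law s : probability R R := convol_mix q (mu (Num.max s 0)).

Lemma jump_law_subker : subker jump_law.
Proof. exact: subker_convol_mix mu_subker. Qed.

Lemma jump_law_conc s : conc (jump_law s).
Proof. by apply: conc_convol_mix; apply: mu_conc; exact: max0_ge0. Qed.

Lemma CDR_generatorE s f x : bounded_C1 f -> 0 <= s -> 0 <= x ->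
  CDR_generator a q mu s f x = gen a jump_law s f x.
Proof.
move=> fC s0 x0; rewrite /CDR_generator /gen -/(Dr f x); congr (_ * _ - _).
have be := bounded_C1_bmeas fC.
have joo : (jump_law s setT < +oo)%E by apply: le1_lty; exact: sprobability_setT.
have bx : bmeas (fun z => ext f (x + z)).
  by apply: (bmeas_comp be); exact: measurable_funD.
rewrite /jump -[X in _ = _ - X](Rint_prob_cst (jump_law s)) -(RintB joo bx); last first.
  exact: bmeas_cst.
rewrite (conc_Rint joo); [|exact: jump_law_conc|by apply: bmeasB => //; exact: bmeas_cst].
rewrite /jump_law max0_id//; apply: eq_Rintegral => z.
rewrite inE /Rp/= in_itv/= andbT => z0.
by rewrite !ext_id// addr_ge0.
Qed.

Section fixed_start.
Variables (r x : R).
Hypotheses (r0 : 0 <= r) (x0 : 0 <= x).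

Lemma P_mass t y : P r t y setT = 1%E.
Proof. exact: prob_kernel. Qed.

Lemma P_conc t : r <= t -> conc (P r t x).
Proof.
move=> rt; apply: on_Rp_conc; first exact: P_mass.
by have [+ _ _] := P_semigroup r0 x0; apply.
Qed.

Lemma P_mild : mild a jump_law r (fun t => P r t x).
Proof.
move=> h t bh rt.
have Poo s : (P r s x setT < +oo)%E by rewrite P_mass ltry.
have [_ _ ev] := P_semigroup r0 x0.
have [ig E] := ev h (bmeas_bounded_borel bh) t rt.
have gE v : r <= v <= t -> mild_integrand a jump_law (fun t => P r t x) h t v =
    expR (a * (v - t)) * pairing (convol (P r v x) (convol_mix q (mu v))) (drift (t - v) h).
  move=> /andP[rv vt]; rewrite /mild_integrand; congr (_ * _).
  have bd : bmeas (drift (t - v) h) by exact: bmeas_drift.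
  have jE : jump_law v = convol_mix q (mu v).
    by rewrite /jump_law max0_id//; exact: le_trans rv.
  rewrite /pairing -conc_Rint//.
  - by rewrite (Rint_convol (convol_mix q (mu v)) (Poo v) bd) /jump jE.
  - exact: convol_lty.
  - apply: conc_convol => //; first exact: P_conc.
    by apply: conc_convol_mix; apply: mu_conc; exact: le_trans rv.
split.
  apply: eq_integrable ig => // v; rewrite inE/= in_itv/= => vrt.
  by rewrite /comp gE.
rewrite -pairingE//; [|exact: P_conc|exact: bmeas_bounded_borel].
rewrite E; congr (_ * _ + _ * _).
  by rewrite /pairing -conc_Rint//; [exact: P_conc|exact: bmeas_drift].
by apply: eq_tint => v /gE ->.
Qed.

End fixed_start.

(** Measurability in x is part of the data; in time the mild equation gives a
    Lipschitz bound for smooth test functions. *)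
Lemma P_subker r : 0 <= r ->
  subker (fun z : R * R => P r (Num.max r z.1) (Num.max z.2 0)).
Proof.
move=> r0; apply: psi_subker.
- by move=> z; exact: P_mass.
- by move=> z; apply: P_conc => //; [exact: max0_ge0|rewrite le_max lexx].
move=> n b b0.
pose Y s x := \int[P r (Num.max r s) (Num.max x 0)]_y psi n b y.
have bpsi : bmeas (psi n b : R -> R) by apply: bmeas_psi => //; exact: measurable_cst.
have : measurable_fun setT (fun z : R * R => Y (Num.max z.1 0) z.2).
  apply: measurable_right_continuous => [s s0|s x s0].
    have kP := spker_subker (P r (Num.max r s)).
    have [mk _] := subker_bmeas kP (bmeas_snd bpsi).
    exact: measurableT_comp mk measurable_max0.
  apply: (@right_cvg_lip _ _ _ (2 * a * 1 + n%:R * 30)) => u su.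
  have := @mild_lip _ a jump_law a_ge0 jump_law_subker r
    (fun t => P r t (Num.max x 0)) _ (P_mild r0 (max0_ge0 x)) (psi n b) 1 (n%:R * 30)
    (Num.max r s) (Num.max r u) (psi_C1 n b).1.
  rewrite ext_psi// Dr_psi// => /(_ _ _ _ _ _) h; apply: (le_trans (h _ _ _ _ _)).
  - by move=> t _; rewrite P_mass.
  - by move=> y; exact: psi_bound.
  - by move=> y; exact: dpsi_bound.
  - by rewrite le_max lexx.
  - by rewrite ge_max !le_max lexx /= (ltW su) orbT.
  rewrite ler_wpM2l//.
    by rewrite addr_ge0// !mulr_ge0.
  exact/max_lip/ltW.
have mE s : Num.max r (Num.max s 0) = Num.max r s.
  by rewrite maxCA [Num.max r 0]max_l// maxC.
have -> : (fun z : R * R => Y (Num.max z.1 0) z.2) =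
    fun z => \int[P r (Num.max r z.1) (Num.max z.2 0)]_y psi n b y.
  by apply/funext => z; rewrite /Y mE.
exact.
Qed.

End CDR_kernels.

(** * Restricted laws of a process *)

Section parameter_integrals.
Context {d} {T : measurableType d} {R : realType}.

Lemma bmeas_tint (G : R * T -> R) s t : bmeas G ->
  bmeas (fun w => tint (fun v => G (v, w)) s t).
Proof.
move=> bG; have [mG [M GM]] := bG.
have bGw w : bmeas (fun v => G (v, w)).
  exact: (@bmeas_comp _ _ _ _ _ G (fun v => (v, w)) bG (pair2_measurable w)).
have lt := @leb_on_lty R s t.
have M0 (w : T) : 0 <= M by exact: (le_trans (normr_ge0 _) (GM (0, w))).
have E : (fun w => tint (fun v => G (v, w)) s t) =
    (fun w => \int[leb_on s t]_v (G (v, w) + M) - \int[leb_on s t]_v M).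
  apply/funext => w; rewrite tintE// (RintD lt (bGw w) (bmeas_cst M)) addrK//.
split; last first.
  exists (M * (fine (leb_on s t setT))) => w; rewrite tintE//.
  have := @le_normr_Rintegral _ _ _ (leb_on s t) setT (fun v => G (v, w)) measurableT
    (bmeas_integrable measurableT lt (bGw w)).
  move=> /le_trans; apply; rewrite -Rintegral_cst//.
  exact: (Rint_le lt (bmeas_norm (bGw w)) (bmeas_cst M) (fun v => GM (v, w))).
rewrite E; apply: measurable_funB; last exact: measurable_cst.
apply: measurableT_comp => //.
pose n1 : {finite_measure set (measurableTypeR R) -> \bar R} := mfrestr measurableT lt.
have E1 (f : R -> \bar R) : (\int[leb_on s t]_x f x = \int[n1]_x f x)%E.
  by apply: eq_measure_integral => A mA _; rewrite /n1/= /mfrestr /mrestr setIT.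
under eq_fun do rewrite E1.
apply: (@measurable_fun_fubini_tonelli_G _ _ _ _ _ n1 (fun z => (G z + M)%:E)).
  by apply/measurable_EFinP; exact: measurable_funD.
move=> z; rewrite lee_fin -lerBlDr sub0r; have /ler_normlP[] := GM z.
by rewrite lerNl.
Qed.

End parameter_integrals.

Lemma Rint_dirac d (T : measurableType d) (R : realType) (x : T) (h : T -> R) :
  measurable_fun setT h -> \int[dirac x]_y h y = h x.
Proof.
move=> mh; rewrite /Rintegral integral_dirac//; last exact/measurable_EFinP.
by rewrite diracT mul1e.
Qed.

Section restricted_probability.
Context {d} {Omega : measurableType d} {R : realType} (Pr : probability Omega R).
Variables (B : set Omega) (mB : measurable B).

(** Integrals against this measure are the integrals over B that define
    conditional expectations. *)
Definition restr_prob : {measure set Omega -> \bar R} := mrestr Pr mB.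

Lemma restr_prob_le1 : (restr_prob setT <= 1)%E.
Proof. by rewrite /restr_prob/= /mrestr setTI probability_le1. Qed.

Lemma restr_probE (Y : Omega -> R) : bmeas Y ->
  (\int[Pr]_(w in B) (Y w)%:E)%E = (\int[restr_prob]_w Y w)%:E.
Proof.
move=> bY; rewrite -RintEFin//; last exact/le1_lty/restr_prob_le1.
rewrite [RHS](@negligible_integral _ _ _ restr_prob setT (~` B)) //.
- rewrite setTD setCK; apply: eq_measure_integral => A mA AB.
  by rewrite /= /mrestr setIidl.
- exact: measurableC.
- by apply: bmeas_integrable => //; exact/le1_lty/restr_prob_le1.
- by rewrite /= /mrestr setICl measure0.
Qed.

Lemma cond_exp_restr (G : set (set Omega)) (Y Z : Omega -> R) :
  G `<=` measurable -> bmeas Z -> bmeas Y -> is_cond_exp Pr G Z Y -> G B ->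
  \int[restr_prob]_w Y w = \int[restr_prob]_w Z w.
Proof.
move=> Gm bZ bY [_ _ _ h] GB; have := h _ GB.
by rewrite !restr_probE// => -[].
Qed.

End restricted_probability.

Lemma restr_cond_exp d (Omega : measurableType d) (R : realType)
    (Pr : probability Omega R) (G : set (set Omega)) (Y Z : Omega -> R) :
  G `<=` measurable -> bmeas Z -> bmeas Y -> measurable_wrt G Y ->
  (forall B (mB : measurable B), G B ->
    \int[restr_prob Pr mB]_w Y w = \int[restr_prob Pr mB]_w Z w) ->
  is_cond_exp Pr G Z Y.
Proof.
move=> Gm bZ bY GY h.
have Poo : (Pr setT < +oo)%E by rewrite probability_setT ltry.
split => //; [exact: bmeas_integrable|exact: bmeas_integrable|].
by move=> B GB; rewrite !(restr_probE Pr (Gm _ GB))// h.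
Qed.

Section processes_on_halfline.
Context {R : realType} {d : measure_display} {Omega : measurableType d}.
Variables (Pr : probability Omega R) (F : R -> set (set Omega)) (X : R -> Omega -> R).
Hypotheses (F_filtration : filtration F) (X_ge0 : forall t w, 0 <= t -> 0 <= X t w)
  (X_cadlag : cadlag X) (X_adapted : adapted F X).
Implicit Types (r s t v : R).

Let F_measurable t : 0 <= t -> F t `<=` measurable.
Proof. by case: F_filtration => _ + _; apply. Qed.

Lemma adapted_measurable t : 0 <= t -> measurable_fun setT (X t).
Proof.
move=> t0 _ B mB; rewrite setTI; apply: (F_measurable t0).
exact: (X_adapted t0 mB).
Qed.

Lemma process_measurable :
  measurable_fun setT (fun z : R * Omega => X (Num.max z.1 0) z.2).
Proof.
apply: measurable_right_continuous => [s s0|s w s0]; first exact: adapted_measurable.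
by have [+ _] := X_cadlag w; apply.
Qed.

(** Progressive measurability: stopping the time at t makes the approximation by
    step functions use times up to t only. *)
Lemma process_progressive t : 0 <= t ->
  measurable_fun setT (fun z : R * g_sigma_algebraType (F t) =>
    X (Num.min (Num.max z.1 0) t) z.2).
Proof.
move=> t0.
apply: (@measurable_right_continuous _ (g_sigma_algebraType (F t)) _
   (fun s w => X (Num.min s t) w)) => [s s0|s w s0].
  have m0 : 0 <= Num.min s t by rewrite le_min s0.
  move=> _ B mB; rewrite setTI; apply: sub_sigma_algebra.
  case: F_filtration => _ _ Fi; apply: (Fi _ _ m0); first by rewrite ge_min lexx orbT.
  exact: (X_adapted m0 mB).
have [st|ts] := ltP s t; last first.
  apply: cvg_near_cst; near=> u; congr X; rewrite min_r//.
  by rewrite (le_trans ts)// ltW//; near: u; exact: nbhs_right_gt.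
have [+ _] := X_cadlag w => /(_ _ s0); apply: cvg_trans.
apply: near_eq_cvg; near=> u; rewrite min_l//.
by rewrite ltW//; near: u; exact: nbhs_right_lt.
Unshelve. all: by end_near. Qed.

Lemma measurable_wrt_sigma t (Y : Omega -> R) : 0 <= t ->
  measurable_fun setT (Y : g_sigma_algebraType (F t) -> R) ->
  measurable_wrt (F t) Y.
Proof.
move=> t0 mY B mB; have := mY measurableT B mB; rewrite setTI.
have [sF _ _] := F_filtration.
by rewrite -[in X in _ -> X](sigma_algebra_id (sF _ t0)).
Qed.

Section law_flow.
Variables (B : set Omega) (mB : measurable B).

Lemma law_flow : exists nu : R -> {measure set R -> \bar R},
  [/\ subker nu, forall s, conc (nu s) &
   forall h s, bmeas h -> 0 <= s ->
     \int[nu s]_x h x = \int[restr_prob Pr mB]_w h (X s w)].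
Proof.
have kk := spker_subker (kdirac process_measurable : R.-pker (R * Omega)%type ~> R).
have [nu [knu nuE]] := mixture_kernel (restr_prob_le1 Pr mB) kk.
have E h s : bmeas h ->
    \int[nu s]_x h x = \int[restr_prob Pr mB]_w h (X (Num.max s 0) w).
  move=> bh; rewrite nuE//; apply: eq_Rintegral => w _.
  by rewrite /kdirac Rint_dirac//; case: bh.
exists nu; split => // [s|h s bh s0]; last by rewrite E// max0_id.
have mR : measurable (~` @Rp R) by apply: measurableC; exact: measurable_Rp.
rewrite /conc -[LHS]fineK; last first.
  rewrite ge0_fin_numE//; apply: le_lt_trans (le1_lty (knu.2 s)).
  by rewrite le_measure ?inE.
rewrite -Rint_indic// E; last exact: bmeas_indic.
rewrite (@eq_Rintegral _ _ _ _ _ (fun _ => 0)) ?Rintegral_cst ?mul0r// => w _.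
rewrite indicE memNset//= /Rp/= in_itv/= andbT; apply.
by apply: X_ge0; exact: max0_ge0.
Qed.

End law_flow.

End processes_on_halfline.

(** * The Markov property and the martingale problem *)

Lemma conc_indic (R : realType) (k : {measure set R -> \bar R}) :
  (k setT < +oo)%E -> \int[k]_x \1_(~` Rp) x = 0 :> R <-> conc k.
Proof.
move=> koo; have mR : measurable (~` @Rp R) by apply: measurableC; exact: measurable_Rp.
rewrite Rint_indic//; split => [k0|ck]; last by rewrite (ck : k (~` Rp) = 0%E).
rewrite /conc -[LHS]fineK ?k0// ge0_fin_numE//; apply: le_lt_trans koo.
by rewrite le_measure ?inE.
Qed.

Section martingale_problem_equivalence.
Context {R : realType}.
Variables (a : R) (q : posdist R) (mu : R -> probability R R).
Variables (P : R -> R -> R.-pker R ~> R).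
Context {d : measure_display} {Omega : measurableType d}.
Variables (Pr : probability Omega R) (F : R -> set (set Omega)) (X : R -> Omega -> R).
Hypotheses (a_ge0 : 0 <= a) (mu_CDR : generalized_CDR a q mu).
Hypothesis P_semigroup : CDR_semigroup a q mu P.
Hypotheses (F_filtration : filtration F) (X_ge0 : forall t w, 0 <= t -> 0 <= X t w)
  (X_cadlag : cadlag X) (X_adapted : adapted F X).
Implicit Types (f h : R -> R) (r s t v x : R).

Let m := jump_law q mu.
Let km : subker m := jump_law_subker mu_CDR.

Let F_measurable t : 0 <= t -> F t `<=` measurable.
Proof. by case: F_filtration => _ + _; apply. Qed.

Let mX t : 0 <= t -> measurable_fun setT (X t).
Proof. exact: adapted_measurable F_filtration X_adapted _. Qed.

Section transition_flow.
Variable r : R.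
Hypothesis r0 : 0 <= r.

Let clipped v x := P r (Num.max r v) x.

(** The clipped family is a kernel in v and agrees with the transition laws from
    time r on, so it inherits their mild equation. *)
Lemma clipped_integrated x : 0 <= x -> integrated a m (fun v => clipped v x) r.
Proof.
move=> x0.
have kc : subker (fun v => clipped v x).
  have [mk k1] := P_subker a_ge0 mu_CDR P_semigroup r0.
  split => [U mU|v]; last by rewrite /clipped P_mass.
  have := measurableT_comp (mk U mU) (@pair2_measurable _ _ R R x).
  by apply: eq_measurable_fun => v _ /=; rewrite max0_id.
apply: mild_integrated => // h t bh rt.
have [ig E] := P_mild mu_CDR P_semigroup r0 x0 bh rt.
have cE v : r <= v <= t -> mild_integrand a m (fun v => clipped v x) h t v =
    mild_integrand a m (fun v => P r v x) h t v.
  by move=> /andP[rv _]; rewrite /mild_integrand /clipped max_r.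
split.
  apply: eq_integrable ig => // v; rewrite inE/= in_itv/= => vrt.
  by rewrite /comp cE.
rewrite /clipped (max_r rt) maxxx E; congr (_ + _ * _).
by apply: eq_tint => v /cE ->.
Qed.

Variables (B : set Omega) (mB : measurable B).
Let l := restr_prob Pr mB.
Let loo : (l setT < +oo)%E. Proof. exact/le1_lty/restr_prob_le1. Qed.

(** Mixing the transition laws over the restricted law of [X r] preserves the
    forward equation, which is linear. *)
Lemma transition_flow : exists nu : R -> {measure set R -> \bar R},
  [/\ subker nu, forall s, conc (nu s), integrated a m nu r &
   forall h s, bmeas h -> r <= s ->
     \int[nu s]_x h x = \int[l]_w \int[P r s (X r w)]_y h y].
Proof.
have X0 w : 0 <= X r w by exact: X_ge0.
have kk : subker (fun z : R * Omega => clipped z.1 (X r z.2)).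
  have [mk k1] := P_subker a_ge0 mu_CDR P_semigroup r0.
  split => [U mU|z]; last by rewrite /clipped P_mass.
  have mz : measurable_fun setT (fun z : R * Omega => (z.1, X r z.2)).
    apply: measurable_fun_pair; first exact: measurable_fst.
    by apply: measurableT_comp measurable_snd; exact: mX.
  have := measurableT_comp (mk U mU) mz; apply: eq_measurable_fun => z _ /=.
  by rewrite max0_id.
have [nu [knu nuE]] := mixture_kernel (restr_prob_le1 Pr mB) kk.
have bker (G : R * R -> R) : bmeas G ->
    bmeas (fun z : R * Omega => \int[clipped z.1 (X r z.2)]_y G (z.1, y)).
  move=> bG; apply: (@subker_bmeas _ _ _ _ _ _
    (fun p : (R * Omega) * R => G (p.1.1, p.2)) kk).
  apply: (bmeas_comp bG); apply: measurable_fun_pair; last exact: measurable_snd.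
  exact: measurableT_comp measurable_fst measurable_fst.
have bslice (G : R * Omega -> R) v : bmeas G -> bmeas (fun w => G (v, w)).
  move=> bG; exact: (@bmeas_comp _ _ _ _ _ G (fun w => (v, w)) bG (pair1_measurable v)).
exists nu; split => //.
- move=> s; apply/conc_indic; first exact: le1_lty (knu.2 s).
  have mR : measurable (~` @Rp R) by apply: measurableC; exact: measurable_Rp.
  rewrite nuE; last exact: bmeas_indic.
  rewrite (@eq_Rintegral _ _ _ _ _ (fun _ => 0)) ?Rintegral_cst ?mul0r// => w _.
  apply/conc_indic; first by rewrite /clipped P_mass ltry.
  have rs : r <= Num.max r s by rewrite le_max lexx.
  exact: (P_conc P_semigroup r0 (X0 w) rs).
- move=> f t fC rt; have be := bounded_C1_bmeas fC.
  have bg := bmeas_gen2 a km fC.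
  have bt := bker _ bg.
  rewrite !nuE//.
  have E w : \int[clipped t (X r w)]_y ext f y = \int[clipped r (X r w)]_y ext f y +
      tint (fun v => \int[clipped v (X r w)]_y gen a m v f y) r t.
    exact: (clipped_integrated (X0 w) fC rt).
  have -> : \int[l]_w \int[clipped t (X r w)]_y ext f y = \int[l]_w
      (\int[clipped r (X r w)]_y ext f y +
        tint (fun v => \int[clipped v (X r w)]_y gen a m v f y) r t).
    by apply: eq_Rintegral => w _; exact: E.
  rewrite (RintD loo); last 2 first.
  + exact: (bslice _ r (bker _ (bmeas_snd be))).
  + exact: (bmeas_tint r t bt).
  congr (_ + _).
  have bI : bmeas (fun v => \int[l]_w \int[clipped v (X r w)]_y gen a m v f y).
    have kl : subker (fun _ : R => l).
      by split => [U mU|_]; [exact: measurable_cst|exact: restr_prob_le1].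
    exact: (subker_bmeas kl bt).
  rewrite -(@tint_fubini _ _ _ l
    (fun z => \int[clipped z.1 (X r z.2)]_y gen a m z.1 f y) r t loo bt bI).
  by apply: eq_tint => v _; rewrite nuE//; exact: bmeas_gen.
- move=> h s bh rs; rewrite (nuE _ _ bh); apply: eq_Rintegral => w _.
  by rewrite /clipped (max_r rs).
Qed.

End transition_flow.

Lemma transition_start r x h : 0 <= r -> 0 <= x -> bmeas h ->
  \int[P r r x]_y h y = h x.
Proof.
move=> r0 x0 [mh _]; rewrite -[RHS](Rint_dirac x mh); congr fine.
apply: eq_measure_integral => A mA _.
by have [_ + _] := P_semigroup r0 x0; apply.
Qed.

(** The process M(f), written with globally defined integrands. *)
Definition compensated f t w : R :=
  ext f (X t w) - ext f (X 0 w) - tint (fun s => gen a m s f (X (Num.max s 0) w)) 0 t.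

Lemma compensatedE f t w : bounded_C1 f -> 0 <= t ->
  f (X t w) - f (X 0 w) - \int[@lebesgue_measure R]_(s in `[0, t])
    CDR_generator a q mu s f (X s w) = compensated f t w.
Proof.
move=> fC t0; rewrite /compensated !ext_id ?X_ge0//; congr (_ - _ - _).
apply: eq_tint => s /andP[s0 _]; rewrite max0_id//.
by apply: CDR_generatorE => //; exact: X_ge0.
Qed.

Let bmeas_genX f : bounded_C1 f ->
  bmeas (fun z : R * Omega => gen a m z.1 f (X (Num.max z.1 0) z.2)).
Proof.
move=> fC; apply: (@bmeas_comp _ _ _ _ _ (fun p : R * R => gen a m p.1 f p.2)
  (fun z : R * Omega => (z.1, X (Num.max z.1 0) z.2)) (bmeas_gen2 a km fC)).
apply: measurable_fun_pair; first exact: measurable_fst.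
exact: process_measurable F_filtration X_cadlag X_adapted.
Qed.

Lemma bmeas_compensated f t : bounded_C1 f -> 0 <= t -> bmeas (compensated f t).
Proof.
move=> fC t0; have be := bounded_C1_bmeas fC; apply: bmeasB.
  by apply: bmeasB; apply: (bmeas_comp be); exact: mX.
exact: (bmeas_tint 0 t (bmeas_genX fC)).
Qed.

Lemma compensated_adapted f t : bounded_C1 f -> 0 <= t ->
  measurable_wrt (F t) (compensated f t).
Proof.
move=> fC t0; apply: (measurable_wrt_sigma F_filtration t0).
have [me _] := bounded_C1_bmeas fC.
have [_ _ Fi] := F_filtration.
have mXt s : 0 <= s -> s <= t ->
    measurable_fun setT (X s : g_sigma_algebraType (F t) -> R).
  move=> s0 st _ C mC; rewrite setTI; apply: sub_sigma_algebra.
  by apply: (Fi _ _ s0 st); exact: (X_adapted s0 mC).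
apply: measurable_funB.
  by apply: measurable_funB; apply: measurableT_comp me _; exact: mXt.
have bG : bmeas (fun z : R * g_sigma_algebraType (F t) =>
    gen a m z.1 f (X (Num.min (Num.max z.1 0) t) z.2)).
  apply: (@bmeas_comp _ _ _ _ _ (fun p : R * R => gen a m p.1 f p.2)
    (fun z : R * g_sigma_algebraType (F t) => (z.1, X (Num.min (Num.max z.1 0) t) z.2))
    (bmeas_gen2 a km fC)).
  apply: measurable_fun_pair; first exact: measurable_fst.
  exact: process_progressive.
have [+ _] := bmeas_tint 0 t bG; apply: eq_measurable_fun => w _.
by apply: eq_tint => s /andP[s0 st]; rewrite max0_id// min_l.
Qed.

(** Increments of the compensated process on an event correspond to the defect in
    the integrated equation for the law of X restricted to that event. *)
Lemma compensated_increment f r t (B : set Omega) (mB : measurable B)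
    (nu : R -> {measure set R -> \bar R}) :
  bounded_C1 f -> 0 <= r -> r <= t ->
  (forall h s, bmeas h -> 0 <= s ->
     \int[nu s]_x h x = \int[restr_prob Pr mB]_w h (X s w)) ->
  \int[restr_prob Pr mB]_w compensated f t w -
    \int[restr_prob Pr mB]_w compensated f r w =
  \int[nu t]_x ext f x - \int[nu r]_x ext f x -
    tint (fun v => \int[nu v]_x gen a m v f x) r t.
Proof.
move=> fC r0 rt nuE; have t0 := le_trans r0 rt; have be := bounded_C1_bmeas fC.
set l := restr_prob Pr mB.
have loo : (l setT < +oo)%E by exact/le1_lty/restr_prob_le1.
have bX s : 0 <= s -> bmeas (fun w => ext f (X s w)).
  by move=> s0; apply: (bmeas_comp be); exact: mX.
have bG := bmeas_genX fC.
pose J w := tint (fun s => gen a m s f (X (Num.max s 0) w)) r t.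
have bJ : bmeas J by exact: (bmeas_tint r t bG).
have bIn : bmeas (fun v => \int[l]_w gen a m v f (X (Num.max v 0) w)).
  have kl : subker (fun _ : R => l).
    by split => [U mU|_]; [exact: measurable_cst|exact: restr_prob_le1].
  exact: (subker_bmeas kl bG).
rewrite -(RintB loo); [|exact: bmeas_compensated..].
rewrite !nuE// -(RintB loo); [|exact: bX..].
have -> : tint (fun v => \int[nu v]_x gen a m v f x) r t = \int[l]_w J w.
  rewrite /J -(@tint_fubini _ _ _ l
    (fun z => gen a m z.1 f (X (Num.max z.1 0) z.2)) r t loo bG bIn).
  apply: eq_tint => v /andP[rv _]; have v0 := le_trans r0 rv.
  have bgv : bmeas (gen a m v f) by exact: bmeas_gen.
  by rewrite (nuE _ _ bgv v0); apply: eq_Rintegral => w _ /=; rewrite max0_id.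
rewrite -(RintB loo)//; last by apply: bmeasB; exact: bX.
apply: eq_Rintegral => w _; rewrite /compensated /J.
rewrite (@tint_cat _ (fun s => gen a m s f (X (Num.max s 0) w)) 0 r t)//; last first.
  apply: bmeas_itv_integrable.
  exact: (@bmeas_comp _ _ _ _ _ (fun z : R * Omega => gen a m z.1 f (X (Num.max z.1 0) z.2))
    (fun v => (v, w)) bG (pair2_measurable w)).
by set u := tint _ _ _; set u' := tint _ _ _; ring.
Qed.

Let bmeas_pairing r t h : 0 <= r -> r <= t -> bounded_borel h ->
  bmeas (fun w => pairing (P r t (X r w)) h) /\
  measurable_wrt (F r) (fun w => pairing (P r t (X r w)) h) /\
  forall w, pairing (P r t (X r w)) h = \int[P r t (X r w)]_y ext h y.
Proof.
move=> r0 rt bh; have be := bmeas_ext bh.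
have E w : pairing (P r t (X r w)) h = \int[P r t (X r w)]_y ext h y.
  apply: pairingE => //; first by rewrite P_mass ltry.
  by apply: (P_conc P_semigroup) => //; exact: X_ge0.
have bk : bmeas (fun x => \int[P r t x]_y ext h y).
  exact: (subker_bmeas (spker_subker (P r t)) (bmeas_snd be)).
under eq_fun do rewrite E.
split; first by apply: (bmeas_comp bk); exact: mX.
split => // B mB /=.
have := X_adapted r0 (bk.1 measurableT _ mB).
by rewrite setTI.
Qed.

Lemma markov_process_martingale_problem :
  markov_process Pr F P X -> martingale_problem Pr F (CDR_generator a q mu) X.
Proof.
move=> [_ markov] f fC.
have be := bounded_C1_bmeas fC.
have mart : martingale Pr F (compensated f).
  split; first by move=> t t0; exact: compensated_adapted.
    move=> t t0; apply: bmeas_integrable => //; last exact: bmeas_compensated.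
    by apply: le1_lty; exact: sprobability_setT.
  move=> r t r0 rt; have t0 := le_trans r0 rt.
  apply: restr_cond_exp; [exact: F_measurable|exact: bmeas_compensated|
    exact: bmeas_compensated|exact: compensated_adapted|].
  move=> B mB FB.
  have [nu [knu cnu nuE]] := law_flow Pr F_filtration X_ge0 X_cadlag X_adapted mB.
  have [nu' [knu' cnu' I' nuE']] := transition_flow r0 mB.
  have same h s : bmeas h -> r <= s -> \int[nu s]_x h x = \int[nu' s]_x h x.
    move=> bh rs; have s0 := le_trans r0 rs.
    have bb := bmeas_bounded_borel bh.
    have [bp [_ pE]] := bmeas_pairing r0 rs bb.
    have bhX : bmeas (fun w => h (X s w)) by apply: (bmeas_comp bh); exact: mX.
    rewrite nuE// nuE'//.
    rewrite -(cond_exp_restr mB (F_measurable r0) bhX bp (markov _ _ _ r0 rs bb) FB).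
    apply: eq_Rintegral => w _; rewrite pE; apply: conc_eq_Rint => //.
    - by rewrite P_mass ltry.
    - by apply: (P_conc P_semigroup) => //; exact: X_ge0.
    - exact: bmeas_ext.
    - by move=> y y0; rewrite ext_id.
  apply/eqP; rewrite eq_sym -subr_eq0; apply/eqP.
  rewrite (compensated_increment fC r0 rt nuE).
  rewrite !same// (I' _ _ fC rt).
  rewrite (@eq_tint _ (fun v => \int[nu v]_x gen a m v f x)
    (fun v => \int[nu' v]_x gen a m v f x)); last first.
    by move=> v /andP[rv _]; apply: same => //; exact: bmeas_gen.
  by set u := tint _ _ _; set u' := Rintegral _ _ _; ring.
have [mA mI mC] := mart.
have E t : 0 <= t -> (fun w => f (X t w) - f (X 0 w) -
    \int[@lebesgue_measure R]_(s in `[0, t]) CDR_generator a q mu s f (X s w)) =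
    compensated f t.
  by move=> t0; apply/funext => w; exact: compensatedE.
split.
- by move=> t t0; rewrite E//; exact: mA.
- by move=> t t0; rewrite E//; exact: mI.
- move=> r t r0 rt; rewrite (E _ r0) (E _ (le_trans r0 rt)); exact: mC.
Qed.

Lemma martingale_problem_markov_process :
  martingale_problem Pr F (CDR_generator a q mu) X -> markov_process Pr F P X.
Proof.
move=> MP; split => // r t h r0 rt bh; have t0 := le_trans r0 rt.
have be := bmeas_ext bh.
have [bp [Fp pE]] := bmeas_pairing r0 rt bh.
have hX : (fun w => h (X t w)) = (fun w => ext h (X t w)).
  by apply/funext => w; rewrite ext_id// X_ge0.
have bhX : bmeas (fun w => ext h (X t w)) by apply: (bmeas_comp be); exact: mX.
rewrite hX; apply: restr_cond_exp => //; first exact: F_measurable.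
move=> B mB FB.
have [nu [knu cnu nuE]] := law_flow Pr F_filtration X_ge0 X_cadlag X_adapted mB.
have [nu' [knu' cnu' I' nuE']] := transition_flow r0 mB.
have I : integrated a m nu r.
  move=> f u fC ru; have u0 := le_trans r0 ru.
  have [_ _ mC] := MP f fC.
  have E s : 0 <= s -> (fun w => f (X s w) - f (X 0 w) -
      \int[@lebesgue_measure R]_(s in `[0, s]) CDR_generator a q mu s f (X s w)) =
      compensated f s.
    by move=> s0; apply/funext => w; exact: compensatedE.
  have := mC r u r0 ru; rewrite !E// => ce.
  have := cond_exp_restr mB (F_measurable r0) (bmeas_compensated fC u0)
    (bmeas_compensated fC r0) ce FB.
  move=> /eqP; rewrite eq_sym -subr_eq0 (compensated_increment fC r0 ru nuE).
  by rewrite subr_eq0 subr_eq addrC => /eqP.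
have init U : measurable U -> nu r U = nu' r U.
  move=> mU; have bU : bmeas (\1_U : R -> R) by exact: bmeas_indic.
  have fin (k : R -> {measure set R -> \bar R}) : subker k -> k r U \is a fin_num.
    move=> kk; rewrite ge0_fin_numE//; apply: le_lt_trans (le1_lty (kk.2 r)).
    by rewrite le_measure ?inE.
  have e : \int[nu r]_x \1_U x = \int[nu' r]_x \1_U x.
    rewrite nuE// nuE'//; apply: eq_Rintegral => w _.
    by rewrite transition_start//; exact: X_ge0.
  rewrite !Rint_indic// in e.
  by have := congr1 EFin e; rewrite !fineK//; exact: fin.
have := flow_unique a_ge0 km knu knu' cnu cnu' I I' init (ext h) rt.
rewrite nuE// nuE'// => ->.
by apply: eq_Rintegral => w _; exact: pE.
Qed.

End martingale_problem_equivalence.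

Theorem theorem4p7 (R : realType) (a : R) (q : posdist R)
    (mu : R -> probability R R) (P : R -> R -> R.-pker R ~> R)
    (d : measure_display) (Omega : measurableType d) (Pr : probability Omega R)
    (F : R -> set (set Omega)) (X : R -> Omega -> R)
    (a_ge0 : 0 <= a)
    (mu_CDR : generalized_CDR a q mu)
    (P_semigroup : CDR_semigroup a q mu P)
    (Pr_complete : measure_is_complete Pr)
    (F_filtration : filtration F)
    (F_usual : usual_hypotheses Pr F)
    (X_ge0 : forall t w, 0 <= t -> 0 <= X t w)
    (X_cadlag : cadlag X)
    (X_adapted : adapted F X) :
  markov_process Pr F P X <-> martingale_problem Pr F (CDR_generator a q mu) X.
Proof.
split.
  exact: (markov_process_martingale_problem a_ge0 mu_CDR P_semigroup F_filtration
    X_ge0 X_cadlag X_adapted).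
exact: (martingale_problem_markov_process a_ge0 mu_CDR P_semigroup F_filtration
  X_ge0 X_cadlag X_adapted).
Qed.
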